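(* Let $(X,d_X)$ be a complete and quasiconvex metric space, and let $(Y,d_Y)$ be any metric space. Let $\Phi:X\to Y$ be a weak BLD mapping. Then for any $k\in\mathbb{N}$ and any Lipschitz map $f:E\to X$ defined on a measurable set $E\subset\mathbb{R}^k$, the following conditions are equivalent: (1) $\mathcal{H}^k(f(E))=0$ in $X$; (2) $\mathcal{H}^k(\Phi(f(E)))=0$ in $Y$.
   Context: $\mathbb{N}=\{1,2,\ldots\}$, measurable means Lebesgue measurable, and $\mathcal{H}^k$ denotes $k$-dimensional Hausdorff measure with respect to the metric of the space in question. The length $\ell_X(\gamma)$ of a curve $\gamma:[a,b]\to X$ in a metric space is the supremum of $\sum_i d_X(\gamma(t_i),\gamma(t_{i+1}))$ over all partitions $a=t_0<\cdots<t_n=b$; a curve is a continuous map from a compact interval, and it is rectifiable if its length is finite. For $\Phi\circ\gamma$ the length $\ell_Y(\Phi\circ\gamma)$ is defined by the same supremum over partitions. Weak BLD (weak bounded length distortion): a mapping $\Phi:X\to Y$ between metric spaces is weak BLD if there is a constant $M\geq 1$ such that for all rectifiable curves $\gamma$ in $X$, $$M^{-1}\ell_X(\gamma)\leq \ell_Y(\Phi\circ\gamma)\leq M\,\ell_X(\gamma).$$ Quasiconvex: a metric space $(X,d)$ is quasiconvex if there is a constant $C_q\geq 1$ such that for any $x,y\in X$ there is a rectifiable curve $\gamma:[0,1]\to X$ with $\gamma(0)=x$, $\gamma(1)=y$ and length $\ell(\gamma)\leq C_q\,d(x,y)$. *)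

(* Defs.v *)
From HB Require Import structures.
From mathcomp Require Import all_boot all_order all_algebra.
From mathcomp Require Import all_classical all_reals all_analysis.

Set Implicit Arguments.
Unset Strict Implicit.
Unset Printing Implicit Defensive.

Import Order.TTheory GRing.Theory Num.Theory.
Import numFieldNormedType.Exports.

Local Open Scope classical_set_scope.
Local Open Scope ring_scope.

(* [completeType] is pointed, whereas this predicate also makes sense for
   an empty space. *)
Definition complete_metric (R : realType) (X : metricType R) : Prop :=
  forall u : nat -> X, cauchy (u @ \oo) -> exists x : X, u @ \oo --> x.

Definition is_curve (R : realType) (X : metricType R) (a b : R)
    (gamma : R -> X) : Prop :=
  a <= b /\ {within `[a, b], continuous gamma}.

(* [itv_partition a b s] says that a :: s is a partition
   a = t_0 < ... < t_n = b with n = size s. *)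
Definition partition_length (R : realType) (X : metricType R) (a b : R)
    (gamma : R -> X) (s : seq R) : R :=
  \sum_(i < size s)
    mdist (gamma (nth b (a :: s) i)) (gamma (nth b (a :: s) i.+1)).

Definition curve_length (R : realType) (X : metricType R) (a b : R)
    (gamma : R -> X) : \bar R :=
  ereal_sup [set (partition_length a b gamma s)%:E | s in itv_partition a b].

Definition rectifiable (R : realType) (X : metricType R) (a b : R)
    (gamma : R -> X) : Prop :=
  is_curve a b gamma /\ (curve_length a b gamma < +oo)%E.

Definition weak_BLD (R : realType) (X Y : metricType R) (Phi : X -> Y) : Prop :=
  exists2 M : R, 1 <= M & forall (a b : R) (gamma : R -> X),
    rectifiable a b gamma ->
    (M^-1%:E * curve_length a b gamma <= curve_length a b (Phi \o gamma))%E /\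
    (curve_length a b (Phi \o gamma) <= M%:E * curve_length a b gamma)%E.

Definition quasiconvex (R : realType) (X : metricType R) : Prop :=
  exists2 C : R, 1 <= C & forall x y : X, exists gamma : R -> X,
    [/\ rectifiable 0 1 gamma, gamma 0 = x, gamma 1 = y &
        (curve_length 0 1 gamma <= (C * mdist x y)%:E)%E].

(* The 0 makes the diameter of the empty set 0 rather than -oo. *)
Definition diameter (R : realType) (X : metricType R) (A : set X) : \bar R :=
  ereal_sup (0%E |` [set (mdist x y)%:E | x in A & y in A]).

(* The k-dimensional Hausdorff measure for k > 0, without the normalizing factor
   (the volume of the unit ball of R^k divided by 2^k), which does not affect
   which sets are null. For k = 0 the empty sets of a cover would count as 1. *)
Definition hausdorff_premeasure (R : realType) (X : metricType R) (k : nat)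
    (delta : R) (A : set X) : \bar R :=
  ereal_inf [set (\sum_(i <oo) diameter (U i) ^+ k)%E | U in
    [set U : nat -> set X | A `<=` \bigcup_i U i /\
                            forall i, (diameter (U i) <= delta%:E)%E]].

Definition hausdorff_measure (R : realType) (X : metricType R) (k : nat)
    (A : set X) : \bar R :=
  ereal_sup [set hausdorff_premeasure k delta A | delta in
    [set delta : R | 0 < delta]].

(* The canonical norm on 'rV[R]_k is the sup norm, hence this definition. *)
Definition euclidean_dist (R : realType) (k : nat) (x y : 'rV[R]_k) : R :=
  Num.sqrt (\sum_(i < k) (x ord0 i - y ord0 i) ^+ 2).

Definition box (R : realType) (k : nat) (a b : 'rV[R]_k) : set 'rV[R]_k :=
  [set x | forall i, a ord0 i < x ord0 i <= b ord0 i].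

Definition box_volume (R : realType) (k : nat) (a b : 'rV[R]_k) : R :=
  \prod_(i < k) (b ord0 i - a ord0 i).

Definition lebesgue_outer (R : realType) (k : nat) (A : set 'rV[R]_k) : \bar R :=
  ereal_inf [set (\sum_(n <oo) (box_volume (ab n).1 (ab n).2)%:E)%E | ab in
    [set ab : nat -> 'rV[R]_k * 'rV[R]_k |
      (forall n i, (ab n).1 ord0 i <= (ab n).2 ord0 i) /\
      A `<=` \bigcup_n box (ab n).1 (ab n).2]].

Definition lebesgue_measurable (R : realType) (k : nat) (E : set 'rV[R]_k) :
    Prop :=
  (@lebesgue_outer R k).-caratheodory E.

Definition lipschitz_map (R : realType) (k : nat) (X : metricType R)
    (E : set 'rV[R]_k) (f : E -> X) : Prop :=
  exists2 L : R, 0 <= L & forall x y : E,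
    mdist (f x) (f y) <= L * euclidean_dist (val x) (val y).

(* Main.v *)
Require Import Defs.
From HB Require Import structures.
From mathcomp Require Import all_boot all_order all_algebra.
From mathcomp Require Import all_classical all_reals all_analysis.
From mathcomp Require Import ring lra zify.

Set Implicit Arguments.
Unset Strict Implicit.
Unset Printing Implicit Defensive.

Import Order.TTheory GRing.Theory Num.Theory.
Import numFieldNormedType.Exports.

Local Open Scope classical_set_scope.
Local Open Scope ring_scope.

(** The implication from [X] to [Y] holds because [Phi] is Lipschitz: quasiconvexity
   turns the upper bound on lengths into one on distances ([BLD_lipschitz]).

   For the converse, extend [f] to the closure [F] of [E] ([lipschitz_extension]), pull
   the metrics of [X] and of [Y] back to [F], and extend each to a Lipschitz
   pseudometric on R^k ([ext_metric]), called [rhof] and [rho]. Null images in [X] and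
   [Y] now mean that [E] is null for [rhof] and for [rho].

   The lower bound on lengths is used once, in [segment_bound]: the [rhof]-distance of
   two points is at most a constant times the [rho]-length of the segment between them.
   The part of the segment in [F] is mapped to [X], and the gaps are filled with nearly
   shortest curves ([fill_gaps]). The curve in [X] is at most [M] times as long as its
   image in [Y]; and since [rho] is locally a multiple of the norm off [F], the
   [rho]-length of a gap pays for the curve that fills it.

   It remains to compare two Lipschitz pseudometrics that satisfy this bound
   ([null_transfer]), by a quantitative form of the metric differentiation of [rho].
   For a lattice vector [v], the mean over lattice points of the squared average speed of
   [rho] along segments parallel to [v] increases as the segments are halved, and it
   is bounded. So the points near which these speeds vary noticeably at infinitely many
   scales form a null set ([bad_null]). Near the other points, at all fine scales,
   parallel segments have about the same speed, and lengths close to the distances of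
   their ends. On the other hand, if [E] is null for [rho], then almost every [x] in
   [E] is the limit of points of [E] whose [rho]-distance to [x] is infinitesimal with
   respect to the norm ([nondegenerate_null]). Hence [rho]-lengths, and so [rhof], are
   small in one direction on a whole cube around [x] ([degenerate_thin]). Such a cube is
   covered by tubes whose cost is a small fraction of its volume ([thin_cover]), and a
   Vitali selection bounds the total ([thin_small_cover]). *)

(** * Null sets *)

Lemma ler_sum_uniq_sub (R : numDomainType) (I : eqType) (s t : seq I) (F : I -> R) :
  uniq s -> {subset s <= t} -> (forall i, 0 <= F i) ->
  \sum_(i <- s) F i <= \sum_(i <- t) F i.
Proof.
elim: s t => [|x s IH] t; first by move=> *; rewrite big_nil sumr_ge0.
move=> /= /andP[xs us] st F0.
have xt : x \in t by apply: st; rewrite mem_head.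
rewrite big_cons (perm_big _ (perm_to_rem xt)) big_cons lerD2l IH//.
move=> y ys; have := st y; rewrite inE ys orbT => /(_ isT).
rewrite (perm_mem (perm_to_rem xt)) inE => /predU1P[yx|//].
by rewrite -yx ys in xs.
Qed.

(** Diameters are taken with respect to a gauge [rho] that need not separate points:
   pseudometrics on R^k, pulled back from [X] and from [Y], are compared below. The
   sums are bounded over all finite lists so that covers can be indexed by any
   countable type. *)
Definition small_cover (R : realType) (T : Type) (rho : T -> T -> R) (k : nat)
    (A : set T) (eta : R) :=
  exists (U : nat -> set T) (d : nat -> R),
    [/\ A `<=` \bigcup_i U i, forall i, 0 <= d i,
        forall i x y, U i x -> U i y -> rho x y <= d i &
        forall s : seq nat, uniq s -> \sum_(i <- s) d i ^+ k <= eta].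

Definition null (R : realType) (T : Type) (rho : T -> T -> R) (k : nat)
    (A : set T) := forall eta : R, 0 < eta -> small_cover rho k A eta.

Section null.
Variables (R : realType) (T : Type) (rho : T -> T -> R) (k : nat).
Hypothesis k_gt0 : (0 < k)%N.

Lemma small_cover_count (I : countType) (U : I -> set T) (d : I -> R)
    (A : set T) (eta : R) :
  A `<=` \bigcup_i U i -> (forall i, 0 <= d i) ->
  (forall i x y, U i x -> U i y -> rho x y <= d i) ->
  (forall s : seq I, uniq s -> \sum_(i <- s) d i ^+ k <= eta) ->
  small_cover rho k A eta.
Proof.
move=> AU d0 Ud sd.
exists (fun n => if pickle_inv n is Some i then U i else set0).
exists (fun n => if @pickle_inv I n is Some i then d i else 0).
split=> [x /AU[i _ Uix]|n|n x y|s us].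
- by exists (pickle i) => //=; rewrite pickleK_inv.
- by case: pickle_inv.
- by case: pickle_inv => [i|//]; exact: (Ud i).
- have -> : \sum_(n <- s) (if @pickle_inv I n is Some i then d i else 0) ^+ k =
            \sum_(i <- pmap (@pickle_inv I) s) d i ^+ k.
    elim: s {us} => [|n s IH]; first by rewrite !big_nil.
    rewrite big_cons IH /=; case: pickle_inv => [i|] /=.
      by rewrite big_cons.
    by rewrite expr0n eqn0Ngt k_gt0 add0r.
  by apply: sd; apply: pmap_uniq us; exact: pickle_invK.
Qed.

Lemma small_coverS (A B : set T) eta :
  A `<=` B -> small_cover rho k B eta -> small_cover rho k A eta.
Proof.
by move=> AB [U [d [BU d0 Ud sd]]]; exists U, d; split=> // x /AB /BU.
Qed.

Lemma small_cover_bigcup (A : nat -> set T) (e : nat -> R) eta :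
  (forall n, small_cover rho k (A n) (e n)) ->
  (forall n, \sum_(i < n) e i <= eta) ->
  small_cover rho k (\bigcup_n A n) eta.
Proof.
move=> Ae se.
have {Ae} /choice[Ud UdP] : forall n, exists Ud : (nat -> set T) * (nat -> R),
    [/\ A n `<=` \bigcup_i Ud.1 i, forall i, 0 <= Ud.2 i,
        forall i x y, Ud.1 i x -> Ud.1 i y -> rho x y <= Ud.2 i &
        forall s : seq nat, uniq s -> \sum_(i <- s) Ud.2 i ^+ k <= e n].
  by move=> n; have [U [d]] := Ae n; exists (U, d).
apply: (@small_cover_count (nat * nat)%type (fun p => (Ud p.1).1 p.2)
  (fun p => (Ud p.1).2 p.2)).
- move=> x [n _ Anx]; have [+ _ _ _] := UdP n => /(_ _ Anx)[i _ Ux].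
  by exists (n, i).
- by move=> [n i] /=; have [] := UdP n.
- by move=> [n i] x y /=; have [_ _ + _] := UdP n; exact.
move=> s us.
pose N := \max_(p <- s) (maxn p.1 p.2).+1.
have sN p : p \in s -> (p.1 < N)%N /\ (p.2 < N)%N.
  move=> ps; have : ((maxn p.1 p.2).+1 <= N)%N by exact: leq_bigmax_seq.
  by rewrite gtn_max => /andP[].
apply: le_trans (se N).
apply: (@le_trans _ _ (\sum_(p <- [seq (n, i) | n <- iota 0 N, i <- iota 0 N])
    (Ud p.1).2 p.2 ^+ k)).
  apply: ler_sum_uniq_sub us _ _.
    move=> [n i] /sN/= [nN iN]; apply/allpairsP; exists (n, i) => /=.
    by rewrite !mem_iota.
  by move=> [n i]; apply: exprn_ge0; have [] := UdP n.
rewrite big_allpairs -(big_mkord xpredT e).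
rewrite /index_iota subn0.
by apply: ler_sum => n _; have [_ _ _ ->//] := UdP n; exact: iota_uniq.
Qed.

Lemma sum_halves_le (eta : R) n : 0 <= eta ->
  \sum_(i < n) eta / 2 ^+ i.+1 <= eta.
Proof.
move=> eta0; suff -> : \sum_(i < n) eta / 2 ^+ i.+1 = eta - eta / 2 ^+ n.
  by rewrite gerBl divr_ge0// exprn_ge0.
elim: n => [|n IH]; first by rewrite big_ord0 expr0 divr1 subrr.
rewrite big_ord_recr /= IH exprS.
have : (2:R) ^+ n != 0 by rewrite expf_neq0.
by move: (2 ^+ n) => a a0; field.
Qed.

Lemma null_bigcup (A : nat -> set T) :
  (forall n, null rho k (A n)) -> null rho k (\bigcup_n A n).
Proof.
move=> An eta eta0; apply: (@small_cover_bigcup _ (fun n => eta / 2 ^+ n.+1)).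
  by move=> n; apply: An; rewrite divr_gt0// exprn_gt0.
by move=> n; apply: sum_halves_le; exact: ltW.
Qed.

Lemma nullS (A B : set T) : A `<=` B -> null rho k B -> null rho k A.
Proof. by move=> AB Bn eta eta0; apply: small_coverS AB _; exact: Bn. Qed.

Lemma nullU (A B : set T) : null rho k A -> null rho k B -> null rho k (A `|` B).
Proof.
move=> An Bn; apply: (@nullS _ (\bigcup_n (if n is 0 then A else B))).
  by move=> x [Ax|Bx]; [exists 0%N|exists 1%N].
by apply: null_bigcup => -[|n].
Qed.

Lemma null_bigcup_count (I : countType) (A : I -> set T) :
  (forall i, null rho k (A i)) -> null rho k (\bigcup_i A i).
Proof.
move=> An; apply: (@nullS _
  (\bigcup_n (if @pickle_inv I n is Some i then A i else set0))).
  by move=> x [i _ Aix]; exists (pickle i) => //=; rewrite pickleK_inv.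
apply: null_bigcup => n; case: pickle_inv => // eta eta0.
exists (fun=> set0), (fun=> 0); split=> // s _.
by rewrite big1 ?ltW// => i _; rewrite expr0n eqn0Ngt k_gt0.
Qed.

End null.

Lemma null_lipschitz (R : realType) (S T : Type) (rho : S -> S -> R)
    (rho' : T -> T -> R) (k : nat) (g : S -> T) (A : set S) (c : R) :
  (0 < k)%N -> 0 <= c ->
  (forall x y, A x -> A y -> rho' (g x) (g y) <= c * rho x y) ->
  null rho k A -> null rho' k (g @` A).
Proof.
move=> k0 c0 gA An eta eta0.
pose c1 := c + 1; have c10 : 0 < c1 by rewrite /c1; lra.
have [U [d [AU d0 Ud sd]]] := An (eta / c1 ^+ k) (divr_gt0 eta0 (exprn_gt0 _ c10)).
exists (fun i => g @` (U i `&` A)), (fun i => c1 * d i).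
split=> [_ [x Ax <-]|i|i _ _ [x [Ux Ax] <-] [y [Uy Ay] <-]|s us].
- by have [i _ Ux] := AU _ Ax; exists i => //; exists x.
- by rewrite mulr_ge0// ltW.
- apply: le_trans (gA _ _ Ax Ay) _.
  have := Ud i x y Ux Uy; have := d0 i; rewrite /c1 => di0 xy.
  have : c * rho x y <= c * d i by rewrite ler_wpM2l.
  by lra.
- under eq_bigr => i _ do rewrite exprMn.
  by rewrite -mulr_sumr mulrC -ler_pdivlMr ?exprn_gt0// sd.
Qed.

(** Null sets of [X] and [Y] become null sets of R^k for the pulled back metrics. *)
Lemma null_image (R : realType) (S T : Type) (rho : T -> T -> R) (k : nat)
    (g : S -> T) (A : set S) : (0 < k)%N ->
  null rho k (g @` A) <-> null (fun x y => rho (g x) (g y)) k A.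
Proof.
move=> k0; split=> [An eta /An[U [d [AU d0 Ud sd]]]|].
  exists (fun i => g @^-1` (U i)), d; split=> // [x Ax|i x y].
    by have [|i _ Ux] := AU (g x); [exists x|exists i].
  by move=> /= Ux Uy; exact: Ud Ux Uy.
apply: (@null_lipschitz _ _ _ _ _ _ _ _ 1) => // x y _ _.
by rewrite mul1r.
Qed.

Lemma eq_null (R : realType) (T : Type) (rho rho' : T -> T -> R) (k : nat) (A : set T) :
  (0 < k)%N -> (forall x y, A x -> A y -> rho x y = rho' x y) ->
  null rho k A <-> null rho' k A.
Proof.
move=> k0 rr'; split; rewrite -{2}[A]image_id;
  by apply: (null_lipschitz (c := 1)) => // x y Ax Ay; rewrite rr'// mul1r.
Qed.

(** A small sum of k-th powers of diameters makes every diameter small, so the bound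
   on the diameters in the premeasure can be dropped for null sets. *)
Lemma hausdorff_null (R : realType) (X : metricType R) (k : nat) (A : set X) :
  (0 < k)%N -> hausdorff_measure k A = 0%E <-> null (@mdist R X) k A.
Proof.
move=> k0.
have diam0 (U : set X) : (0 <= diameter U)%E.
  by apply: ereal_sup_ubound; left.
have diamX0 (U : set X) : (0 <= diameter U ^+ k)%E by exact: expe_ge0.
have pre0 delta : (0 <= hausdorff_premeasure k delta A)%E.
  apply: le_ereal_inf_tmp => _ [U _ <-]; exact: nneseries_ge0.
split=> [A0 eta eta0|An].
  have : (hausdorff_premeasure k 1 A <= 0)%E.
    by rewrite -A0; apply: ereal_sup_ubound; exists 1 => //=.
  move=> pre1.
  have {pre0 pre1} pre1 : hausdorff_premeasure k 1 A = 0%E.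
    by apply/eqP; rewrite eq_le pre1 pre0.
  have [|_ [U [AU U1] <-] sU] := @lb_ereal_inf_adherent R
      [set (\sum_(i <oo) diameter (U i) ^+ k)%E | U in
    [set U : nat -> set X | A `<=` \bigcup_i U i /\
                            forall i, (diameter (U i) <= 1%:E)%E]] _ eta0.
    by rewrite -/(hausdorff_premeasure k 1 A) pre1.
  rewrite -/(hausdorff_premeasure k 1 A) pre1 add0e in sU.
  have Ufin i : diameter (U i) \is a fin_num.
    by rewrite ge0_fin_numE//; apply: le_lt_trans (U1 i) _; exact: ltry.
  exists U, (fun i => fine (diameter (U i))); split=> // [i|i x y Ux Uy|s us].
  - exact: fine_ge0.
  - rewrite -lee_fin fineK//; apply: ereal_sup_ubound; right.
    by exists x => //; exists y.
  pose N := \max_(p <- s) p.+1.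
  apply: (@le_trans _ _ (\sum_(i <- iota 0 N) fine (diameter (U i)) ^+ k)).
    apply: ler_sum_uniq_sub us _ _ => [n ns|n].
      by rewrite mem_iota/= add0n; exact: leq_bigmax_seq.
    by rewrite exprn_ge0// fine_ge0.
  rewrite -lee_fin; apply: le_trans (ltW sU).
  have -> : (\sum_(i <- iota 0 N) fine (diameter (U i)) ^+ k)%:E =
      (\sum_(0 <= i < N) diameter (U i) ^+ k)%E.
    rewrite /index_iota subn0 -sumEFin; apply: eq_bigr => i _.
    by rewrite EFin_expe fineK.
  exact: nneseries_lim_ge.
apply/eqP; rewrite eq_le; apply/andP; split; last first.
  apply: le_trans (pre0 1) _; apply: ereal_sup_ubound; exists 1 => //=.
apply: ge_ereal_sup => _ [delta /= delta0 <-].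
apply/lee_addgt0Pr => e e0; rewrite add0e.
pose eta := Num.min e (delta ^+ k).
have eta0 : 0 < eta by rewrite lt_min e0 exprn_gt0.
have [U [d [AU d0 Ud sd]]] := An _ eta0.
have diamd i : (diameter (U i) <= (d i)%:E)%E.
  apply: ge_ereal_sup => _ [->|[x Ux [y Uy <-]]]; rewrite lee_fin//.
  exact: Ud Ux Uy.
apply: ge_ereal_inf; exists (\sum_(i <oo) diameter (U i) ^+ k)%E.
  exists U => //; split=> // i; apply: le_trans (diamd i) _.
  rewrite lee_fin -(@ler_pXn2r _ k)// ?nnegrE// ?(ltW delta0)//.
  by have := sd [:: i] isT; rewrite big_seq1 le_min => /andP[].
apply: lime_le; first by apply: is_cvg_ereal_nneg_natsum => n _.
near=> n.
apply: (@le_trans _ _ (\sum_(0 <= i < n) (d i ^+ k)%:E)%E).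
  apply: lee_sum => i _; rewrite EFin_expe.
  elim: k {k0 diamX0 pre0 An eta eta0 sd} => [|k' IH]; first by rewrite !expe0.
  by rewrite !expeS; apply: lee_pmul => //; exact: expe_ge0.
rewrite sumEFin lee_fin; apply: le_trans (sd _ _) _; first exact: iota_uniq.
by rewrite ge_min lexx.
Unshelve. all: by end_near. Qed.

(** * Lattice points and disjoint cubes *)

Lemma rV_norm_leP (R : realType) (k : nat) (x : 'rV[R]_k) (c : R) : 0 <= c ->
  (`|x| <= c) <-> (forall i, `|x ord0 i| <= c).
Proof.
move=> c0; rewrite {1}/Num.norm /= mx_normrE; split.
  move=> xc i; apply: le_trans xc.
  exact: (le_bigmax 0 (fun ij : 'I_1 * 'I_k => `|x ij.1 ij.2|) (ord0, i)).
move=> xc; apply/bigmax_leP; split=> // -[i j] _ /=; rewrite (ord1 i).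
exact: xc.
Qed.

Lemma ler_rV_norm (R : realType) (k : nat) (x : 'rV[R]_k) i : `|x ord0 i| <= `|x|.
Proof. by move: i; apply/rV_norm_leP. Qed.

Section greedy.
Variables (I : countType) (q : I -> nat) (meets : I -> I -> Prop).

Let prec i j := (q i < q j)%N \/ (q i = q j /\ (pickle i < pickle j)%N).

Let prec_wf : well_founded prec.
Proof.
have H n m i : (q i < n)%N \/ (q i = n /\ (pickle i < m)%N) -> Acc prec i.
  elim: n m i => [|n IHn] m i.
    elim: m i => [|m IHm] i [//|[qi pi]]; first by rewrite ltn0 in pi.
    constructor=> j [|[qji pji]]; first by rewrite qi.
    by apply: IHm; right; split; [rewrite qji|apply: leq_trans pji _].
  have IHn' j : (q j < n.+1)%N -> Acc prec j.
    rewrite ltnS leq_eqVlt => /orP[/eqP qj|qj].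
      by apply: (IHn (pickle j).+1); right.
    by apply: (IHn 0%N); left.
  case=> [/IHn'//|].
  elim: m i => [|m IHm] i [qi pi]; first by rewrite ltn0 in pi.
  constructor=> j [qj|[qji pji]]; first by apply: IHn'; rewrite -qi.
  by apply: IHm; split; [rewrite qji|apply: leq_trans pji _].
by move=> i; apply: (H (q i).+1 0%N); left.
Qed.

(** Vitali selection: indices are ordered by scale, ties being broken by an
   enumeration, and each is kept unless it meets one that is kept before. *)
Lemma greedy_selection (V : set I) : (forall i j, meets i j -> meets j i) ->
  exists2 D : set I, D `<=` V &
    (forall i j, D i -> D j -> i != j -> ~ meets i j) /\
    (forall i, V i -> exists j, [/\ D j, (q j <= q i)%N & j = i \/ meets j i]).
Proof.
move=> meetsC.
pose F i (S : forall j, prec j i -> Prop) : Prop :=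
  V i /\ forall j (h : prec j i), S j h -> ~ meets j i.
pose D := Fix prec_wf (fun=> Prop) F.
have DE i : D i = (V i /\ forall j, prec j i -> D j -> ~ meets j i).
  rewrite /D Fix_eq// => x f g fg; congr F.
  by apply: functional_extensionality_dep => y; apply/funext => h; exact: fg.
have prec_total i j : i != j -> prec i j \/ prec j i.
  move=> ij; have [qij|qij|qij] := ltngtP (q i) (q j); [by left; left|by right; left|].
  have [pij|pij|pij] := ltngtP (pickle i) (pickle j).
  - by left; right.
  - by right; right.
  - by rewrite (pcan_inj (@pickleK I) pij) eqxx in ij.
exists D; first by move=> i; rewrite DE => -[].
split=> [i j Di Dj ij|i Vi].
  have [pij|pji] := prec_total _ _ ij.
    by move: Dj; rewrite DE => -[_ /(_ _ pij Di)].
  by move=> /meetsC; move: Di; rewrite DE => -[_ /(_ _ pji Dj)].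
have [Di|nDi] := pselect (D i); first by exists i; split=> //; left.
move: nDi; rewrite DE => /not_andP[//|/existsNP[j /not_implyP[pji]]].
move=> /not_implyP[Dj /contrapT mji]; exists j; split=> //; last by right.
by case: pji => [/ltnW//|[-> _]].
Qed.

End greedy.

Section grid.
Variables (R : realType) (k : nat).
Implicit Types (w a u : 'rV[int]_k) (N q b s : nat).

Definition gridpt N w : 'rV[R]_k := \row_i ((w ord0 i)%:~R / 2 ^+ N).

Lemma gridptD N w a : gridpt N (w + a) = gridpt N w + gridpt N a.
Proof. by apply/rowP => i; rewrite !mxE rmorphD mulrDl. Qed.

Lemma gridpt0 N : gridpt N 0 = 0.
Proof. by apply/rowP => i; rewrite !mxE mul0r. Qed.

Lemma gridpt_refine N q u : (q <= N)%N -> gridpt N (u *+ 2 ^ (N - q)) = gridpt q u.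
Proof.
move=> qN; apply/rowP => i; rewrite !mxE mulmxnE rmorphMn/= -mulr_natl natrX.
rewrite -{2}(subnK qN) exprD invfM.
have : (2:R) ^+ (N - q) != 0 by rewrite expf_neq0.
have : (2:R) ^+ q != 0 by rewrite expf_neq0.
by move: (2 ^+ (N - q)) (2 ^+ q) => x y x0 y0; field; rewrite x0.
Qed.

Lemma gridptZ N w n : gridpt N (w *+ n) = n%:R *: gridpt N w.
Proof. by apply/rowP => i; rewrite !mxE mulmxnE rmorphMn/= -mulr_natl mulrA. Qed.

Lemma gridpt_scale N w : gridpt N w = (2 ^+ N)^-1 *: gridpt 0 w.
Proof. by apply/rowP => i; rewrite !mxE expr0 divr1 mulrC. Qed.

Lemma gridpt_near N (x : 'rV[R]_k) : exists w, `|gridpt N w - x| <= 2 ^- N.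
Proof.
exists (\row_i Num.floor (x ord0 i * 2 ^+ N)).
apply/rV_norm_leP => [|i]; first by rewrite invr_ge0 exprn_ge0.
rewrite !mxE -(@ler_pM2r _ (2 ^+ N)) ?exprn_gt0// mulVf ?expf_neq0//.
rewrite -[X in _ * X]gtr0_norm ?exprn_gt0// -normrM mulrBl mulfVK ?expf_neq0//.
have /andP[h1 h2] := floor_itv (x ord0 i * 2 ^+ N).
rewrite ler_norml; rewrite rmorphD/= in h2; apply/andP; split; lra.
Qed.

(** The lattice points of a closed cube, as a list so that functions can be
   summed over them. *)
Definition zbox a b : seq 'rV[int]_k :=
  [seq \row_i (a ord0 i - b%:Z + (f i : nat)%:Z) | f : {ffun 'I_k -> 'I_(b.*2.+1)}].

Lemma mem_zboxP a b w :
  reflect (forall i, `|w ord0 i - a ord0 i| <= b%:Z) (w \in zbox a b).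
Proof.
apply: (iffP mapP) => [[f _ ->] i|wab].
  rewrite mxE ler_norml; have := ltn_ord (f i); move: (nat_of_ord (f i)) (a ord0 i) => x y xb; lia.
have h i : (`|(w ord0 i - a ord0 i + b%:Z)%R|%N < b.*2.+1)%N.
  by have := wab i; lia.
exists [ffun i => Ordinal (h i)]; first by rewrite mem_enum.
apply/rowP => i; rewrite !mxE ffunE /=.
have E (x y : int) : `|x - y| <= b%:Z -> x = y - b%:Z + (`|(x - y + b%:Z)%R|%N)%:Z.
  by rewrite ler_norml; lia.
exact: E (wab i).
Qed.

Lemma zbox_uniq a b : uniq (zbox a b).
Proof.
rewrite map_inj_uniq ?enum_uniq// => f g /rowP fg; apply/ffunP => i.
by apply: val_inj; have := fg i; rewrite !mxE /=; lia.
Qed.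

Lemma size_zbox a b : size (zbox a b) = (b.*2.+1 ^ k)%N.
Proof. by rewrite size_map -cardE card_ffun !card_ord. Qed.

Lemma gridpt_zboxP N a b w :
  w \in zbox a b <-> `|gridpt N w - gridpt N a| <= b%:R / 2 ^+ N.
Proof.
rewrite rV_norm_leP ?divr_ge0// ?exprn_ge0//.
have E i : (`|w ord0 i - a ord0 i| <= b%:Z) =
    (`|(gridpt N w - gridpt N a) ord0 i| <= b%:R / 2 ^+ N).
  rewrite !mxE -mulrBl normrM normfV [`|2 ^+ N|]gtr0_norm ?exprn_gt0//.
  rewrite ler_pM2r ?invr_gt0 ?exprn_gt0// -rmorphB/= -intr_norm.
  by rewrite [b%:R in RHS]pmulrn ler_int.
by split=> [/mem_zboxP h i|h]; [rewrite -E|apply/mem_zboxP => i; rewrite E].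
Qed.

Lemma sum_zbox_shift (h : 'rV[int]_k -> R) a b a' b' t : (forall w, 0 <= h w) ->
  (forall w, w \in zbox a b -> w + t \in zbox a' b') ->
  \sum_(w <- zbox a b) h (w + t) <= \sum_(w <- zbox a' b') h w.
Proof.
move=> h0 ab; rewrite -(big_map (fun w => w + t) xpredT h).
apply: ler_sum_uniq_sub => //.
  by rewrite (map_inj_uniq (@addIr _ t)) zbox_uniq.
by move=> _ /mapP[w wab ->]; exact: ab.
Qed.

(** Balls of the sup norm are cubes; those of scale [q] get half side [2^(s-q)]. *)
Definition half_side s q : R := 2 ^+ s / 2 ^+ q.

Lemma half_side_gt0 s q : 0 < half_side s q.
Proof. by rewrite divr_gt0// exprn_gt0. Qed.

Lemma half_side_le s q : half_side s q <= (2 ^ s)%:R.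
Proof.
by rewrite /half_side ler_pdivrMr ?exprn_gt0// natrX ler_peMr ?exprn_ge0// exprn_ege1// ler1n.
Qed.

Lemma half_side_le1 s q : (s <= q)%N -> half_side s q <= 1.
Proof.
by move=> sq; rewrite /half_side ler_pdivrMr ?exprn_gt0// mul1r ler_weXn2l// ler1n.
Qed.

Definition meets s (i j : nat * 'rV[int]_k) :=
  `|gridpt i.1 i.2 - gridpt j.1 j.2| <= half_side s i.1 + half_side s j.1.

Lemma meetsC s i j : meets s i j -> meets s j i.
Proof. by move=> ij; rewrite /meets distrC [leRHS]addrC. Qed.

(** Lattice points at the common fine scale [N] serve as a volume: disjoint
   cubes inside a large cube account for disjoint sets of lattice points. *)
Lemma sum_disjoint_zbox (h : 'rV[int]_k -> R) (D : seq (nat * 'rV[int]_k)) s N M W :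
  (forall w, 0 <= h w) -> uniq D ->
  (forall i, i \in D -> (i.1 <= N)%N) ->
  (forall i, i \in D -> `|gridpt i.1 i.2| <= M%:R /\ half_side s i.1 <= W%:R) ->
  (forall i j, i \in D -> j \in D -> i != j -> ~ meets s i j) ->
  \sum_(i <- D) \sum_(w <- zbox (i.2 *+ 2 ^ (N - i.1)) (2 ^ (s + (N - i.1)))) h w
  <= \sum_(w <- zbox 0 (2 ^ N * (M + W))) h w.
Proof.
move=> h0 uD DN DM disj.
have inball i w : i \in D -> w \in zbox (i.2 *+ 2 ^ (N - i.1)) (2 ^ (s + (N - i.1))) ->
    `|gridpt N w - gridpt i.1 i.2| <= half_side s i.1.
  move=> iD /(gridpt_zboxP N); rewrite gridpt_refine ?DN// => /le_trans; apply.
  rewrite /half_side natrX exprD -{2}(subnK (DN _ iD)) exprD.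
  have : (2:R) ^+ (N - i.1) != 0 by rewrite expf_neq0.
  have : (2:R) ^+ i.1 != 0 by rewrite expf_neq0.
  move: (2 ^+ (N - _)) (2 ^+ i.1) => x y x0 y0.
  by rewrite le_eqVlt; apply/orP; left; apply/eqP; field; rewrite x0.
pose B (i : nat * 'rV[int]_k) := zbox (i.2 *+ 2 ^ (N - i.1)) (2 ^ (s + (N - i.1))).
rewrite -/(B _) (_ : \sum_(i <- D) _ = \sum_(w <- flatten [seq B i | i <- D]) h w); last first.
  by rewrite big_flatten big_map.
apply: ler_sum_uniq_sub => //.
  elim: D uD DN DM disj inball => // i D IH /= /andP[iD uD] DN DM disj inball.
  rewrite cat_uniq zbox_uniq IH//; last first.
  - by move=> j w jD; apply: inball; rewrite inE jD orbT.
  - by move=> j l jD lD; apply: disj; rewrite inE ?jD ?lD orbT.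
  - by move=> j jD; apply: DM; rewrite inE jD orbT.
  - by move=> j jD; apply: DN; rewrite inE jD orbT.
  rewrite andbT/=; apply/hasPn => w /flattenP[_ /mapP[j jD ->] wj].
  apply/negP => wi; apply: (disj i j); rewrite ?mem_head// ?inE ?jD ?orbT//.
    by apply/eqP => ij; rewrite ij jD in iD.
  rewrite /meets -[_ - _](subrKA (gridpt N w)).
  apply: le_trans (ler_normD _ _) _; rewrite lerD//.
    by rewrite distrC inball// mem_head.
  by rewrite inball// inE jD orbT.
move=> w /flattenP[_ /mapP[i iD ->] wi].
apply/(gridpt_zboxP N); rewrite gridpt0 subr0 natrM natrX mulrAC divff ?expf_neq0//.
rewrite mul1r natrD -[gridpt N w](subrK (gridpt i.1 i.2)) addrC.
have [ciM riW] := DM _ iD.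
apply: le_trans (ler_normD _ _) _; rewrite lerD//.
exact: le_trans (inball _ _ iD wi) riW.
Qed.

Lemma packing_bound (D : seq (nat * 'rV[int]_k)) s M W : (0 < M)%N -> uniq D ->
  (forall i, i \in D -> `|gridpt i.1 i.2| <= M%:R /\ half_side s i.1 <= W%:R) ->
  (forall i j, i \in D -> j \in D -> i != j -> ~ meets s i j) ->
  \sum_(i <- D) half_side s i.1 ^+ k <= (3 * (M%:R + W%:R)) ^+ k.
Proof.
move=> M0 uD DM disj; pose N := \max_(i <- D) i.1.
have DN i : i \in D -> (i.1 <= N)%N by move=> iD; exact: leq_bigmax_seq.
have := @sum_disjoint_zbox (fun=> 1) D s N M W (fun=> ler01) uD DN DM disj.
rewrite [leRHS]big_const_seq count_predT iter_addr addr0 size_zbox => sumD.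
rewrite -(@ler_pM2r _ ((2 ^+ N) ^+ k)) ?exprn_gt0// mulr_suml.
have {}sumD := le_trans _ sumD; apply: (le_trans (sumD _ _)) => {sumD}.
  rewrite big_seq [leRHS]big_seq; apply: ler_sum => i iD.
  rewrite big_const_seq count_predT iter_addr addr0 size_zbox natrX.
  rewrite -exprMn lerXn2r ?nnegrE ?mulr_ge0 ?(ltW (half_side_gt0 _ _)) ?exprn_ge0//.
  rewrite (_ : half_side s i.1 * 2 ^+ N = (2 ^ (s + (N - i.1)))%:R); first by rewrite ler_nat -addnn -addnS leq_addr.
  rewrite /half_side natrX exprD -{1}(subnK (DN _ iD)) exprD.
  have : (2:R) ^+ i.1 != 0 by rewrite expf_neq0.
  by move: (2 ^+ (N - _)) (2 ^+ i.1) => x y x0; field.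
rewrite natrX -exprMn lerXn2r ?nnegrE ?mulr_ge0 ?addr_ge0 ?exprn_ge0//.
rewrite -natrD -natrX -!natrM ler_nat.
have : (0 < 2 ^ N)%N by rewrite expn_gt0.
move: (2 ^ N)%N => x x0; nia.
Qed.

End grid.

(** * The energy of the average speeds *)

Lemma big_ord_doubled (R : nmodType) (F : nat -> R) m :
  \sum_(i < m.*2) F i = \sum_(i < m) (F i.*2 + F i.*2.+1).
Proof.
elim: m => [|m IH]; first by rewrite !big_ord0.
by rewrite doubleS !big_ord_recr /= IH addrA.
Qed.

Lemma big_nat_shift (R : nmodType) (F : nat -> R) q n :
  \sum_(q <= l < q + n) F l = \sum_(l < n) F (q + l)%N.
Proof.
rewrite -{1}[q]add0n big_addn addnC addnK big_mkord.
by apply: eq_bigr => l _; rewrite addnC.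
Qed.

(** The Lipschitz bound also makes [rho x x] vanish. *)
Record lip_pmetric (R : realType) (k : nat) (Lam : R)
    (rho : 'rV[R]_k -> 'rV[R]_k -> R) : Prop := LipPMetric {
  lpm_ge0 : forall x y, 0 <= rho x y;
  lpm_sym : forall x y, rho x y = rho y x;
  lpm_tri : forall y x z, rho x z <= rho x y + rho y z;
  lpm_lip : forall x y, rho x y <= Lam * `|x - y| }.

Section energy.
Variables (R : realType) (k : nat) (Lam : R) (rho : 'rV[R]_k -> 'rV[R]_k -> R).
Hypothesis Lam_ge0 : 0 <= Lam.
Hypothesis rhoP : lip_pmetric Lam rho.
Variables (v : 'rV[int]_k) (t : nat).
Local Notation gridpt := (@gridpt R k).
Local Notation half_side := (@half_side R).
Local Notation meets := (@meets R k).
Hypothesis vt : `|gridpt 0 v| <= 2 ^+ t.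
Implicit Types (x y z : 'rV[R]_k) (l n q N : nat) (u w : 'rV[int]_k).

(** The average speed of [rho] along the segment from [z] to [z + 2^-l v]. *)
Definition speed l z : R := 2 ^+ l * rho z (z + gridpt l v).

Lemma speed_ge0 l z : 0 <= speed l z.
Proof. by rewrite mulr_ge0 ?exprn_ge0 ?(lpm_ge0 rhoP). Qed.

Lemma norm_gridpt_le l : `|gridpt l v| <= 2 ^+ t / 2 ^+ l.
Proof.
rewrite gridpt_scale normrZ gtr0_norm ?invr_gt0 ?exprn_gt0// mulrC.
by rewrite ler_pM2r ?invr_gt0 ?exprn_gt0.
Qed.

Lemma speed_le l z : speed l z <= Lam * 2 ^+ t.
Proof.
apply: (@le_trans _ _ (2 ^+ l * (Lam * (2 ^+ t / 2 ^+ l)))).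
  rewrite ler_wpM2l ?exprn_ge0//; apply: le_trans (lpm_lip rhoP _ _) _.
  by rewrite ler_wpM2l// opprD addNKr normrN norm_gridpt_le.
have : (2:R) ^+ l != 0 by rewrite expf_neq0.
by move: (2 ^+ l) => a a0; rewrite le_eqVlt; apply/orP; left; apply/eqP; field.
Qed.

Lemma speed_lip l x y : `|speed l x - speed l y| <= 2 * Lam * 2 ^+ l * `|x - y|.
Proof.
have h x' y' : rho x' (x' + gridpt l v) <= rho y' (y' + gridpt l v) + 2 * Lam * `|x' - y'|.
  apply: le_trans (lpm_tri rhoP y' _ _) _.
  apply: le_trans (lerD (lexx _) (lpm_tri rhoP (y' + gridpt l v) _ _)) _.
  have h1 := lpm_lip rhoP x' y'.
  have := lpm_lip rhoP (y' + gridpt l v) (x' + gridpt l v).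
  by rewrite opprD addrACA subrr addr0 (distrC y'); lra.
rewrite /speed -mulrBr normrM ger0_norm ?exprn_ge0// [leRHS]mulrAC mulrC.
rewrite ler_wpM2r ?exprn_ge0// ler_norml.
by have := h x y; have := h y x; rewrite (distrC y x); lra.
Qed.

Lemma gridpt_half l : gridpt l.+1 v + gridpt l.+1 v = gridpt l v.
Proof. by rewrite -gridptD -mulr2n -(gridpt_refine R v (leqnSn l)) subSnn. Qed.

Lemma speed_mid l z :
  2 * speed l z <= speed l.+1 z + speed l.+1 (z + gridpt l.+1 v).
Proof.
rewrite /speed -addrA gridpt_half -mulrDr mulrA -exprS ler_pM2l ?exprn_gt0//.
exact: (lpm_tri rhoP).
Qed.

(** By [speed_mid] the speed at a scale is at most the mean of two speeds at the next
   one. Squares make the defect control both the failure of additivity and the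
   difference of the two halves, which speeds alone would not. *)
Definition deficit l z : R :=
  (speed l.+1 z ^+ 2 + speed l.+1 (z + gridpt l.+1 v) ^+ 2) / 2 - speed l z ^+ 2.

Lemma deficit_ge0 l z : 0 <= deficit l z.
Proof.
rewrite /deficit; have := speed_mid l z; have := speed_ge0 l z.
move: (speed l z) (speed l.+1 z) (speed l.+1 (_ + _)) => a b c a0 abc.
have : (2 * a) ^+ 2 <= (b + c) ^+ 2 by rewrite lerXn2r ?nnegrE//; lra.
have := sqr_ge0 (b - c); rewrite !expr2; lra.
Qed.

(** This grows with [n] by averages of deficits, and bounds the variance of the speeds
   at the fine scale [q + n] around the speed at scale [q] ([excess_variance]). *)
Definition excess n q z : R :=
  (\sum_(s < 2 ^ n) speed (q + n) (z + s%:R *: gridpt (q + n) v) ^+ 2) / 2 ^+ n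
  - speed q z ^+ 2.

Lemma gridpt_double l s : s.*2%:R *: gridpt l.+1 v = s%:R *: gridpt l v.
Proof. by rewrite -mul2n mulnC natrM -scalerA [2%:R *: _]scaler_nat mulr2n gridpt_half. Qed.

Lemma excessS n q z : excess n.+1 q z = excess n q z +
  (\sum_(s < 2 ^ n) deficit (q + n) (z + s%:R *: gridpt (q + n) v)) / 2 ^+ n.
Proof.
rewrite /excess expnS mul2n addnS.
rewrite (big_ord_doubled (fun s => speed (q + n).+1 (z + s%:R *: gridpt (q + n).+1 v) ^+ 2)).
under eq_bigr => s _ do rewrite -[_.*2.+1]addn1 natrD scalerDl scale1r gridpt_double addrA.
rewrite /deficit [in RHS]big_split /= sumrN -mulr_suml exprS.
have : (2:R) ^+ n != 0 by rewrite expf_neq0.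
by move: (2 ^+ n) (\sum_(i < _) _) (\sum_(i < _) _) => A S1 S2 A0; field.
Qed.

Lemma excess0 q z : excess 0 q z = 0.
Proof.
by rewrite /excess big_ord_recl big_ord0 addn0 scale0r !addr0 expr0 divr1 subrr.
Qed.

Lemma excess_nd n q z : excess n q z <= excess n.+1 q z.
Proof.
rewrite excessS lerDl divr_ge0 ?exprn_ge0// sumr_ge0// => s _.
exact: deficit_ge0.
Qed.

Lemma excess_le n n' q z : (n <= n')%N -> excess n q z <= excess n' q z.
Proof. by move: n n'; apply/nondecreasing_seqP => n; exact: excess_nd. Qed.

Lemma excessE n q z : excess n q z =
  \sum_(l < n) (\sum_(s < 2 ^ l) deficit (q + l) (z + s%:R *: gridpt (q + l) v)) / 2 ^+ l.
Proof.
elim: n => [|n IH]; first by rewrite excess0 big_ord0.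
by rewrite excessS IH big_ord_recr.
Qed.

Lemma speed_avg n q z :
  2 ^+ n * speed q z <= \sum_(s < 2 ^ n) speed (q + n) (z + s%:R *: gridpt (q + n) v).
Proof.
elim: n => [|n IH].
  by rewrite big_ord_recl big_ord0 addn0 scale0r !addr0 expr0 mul1r.
rewrite expnS mul2n addnS.
rewrite (big_ord_doubled (fun s => speed (q + n).+1 (z + s%:R *: gridpt (q + n).+1 v))).
rewrite exprS -mulrA; apply: (@le_trans _ _
  (2 * \sum_(s < 2 ^ n) speed (q + n) (z + s%:R *: gridpt (q + n) v))).
  by rewrite ler_pM2l.
rewrite mulr_sumr; apply: ler_sum => s _.
by rewrite -[_.*2.+1]addn1 natrD scalerDl scale1r gridpt_double addrA speed_mid.
Qed.

(** For a fine speed [b] and the coarse one [c], [(b - c)^2 = b^2 - c^2 - 2 c (b - c)],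
   and the mean of [b] is at least [c]. *)
Lemma excess_variance n q z :
  \sum_(s < 2 ^ n) (speed (q + n) (z + s%:R *: gridpt (q + n) v) - speed q z) ^+ 2
  <= 2 ^+ n * excess n q z.
Proof.
rewrite /excess mulrBr mulrC divfK ?expf_neq0//.
under eq_bigr => s _ do rewrite sqrrB.
rewrite big_split /= big_split /= sumrN sumr_const card_ord -[_ *+ (2 ^ n)]mulr_natl natrX.
have h : 2 ^+ n * speed q z ^+ 2 *+ 2 <=
  \sum_(s < 2 ^ n) speed (q + n) (z + s%:R *: gridpt (q + n) v) * speed q z *+ 2.
  rewrite sumrMnl lerMn2r orbC -mulr_suml expr2 mulrA.
  by rewrite ler_wpM2r ?speed_ge0// speed_avg.
rewrite mulr2n in h; lra.
Qed.

(** The excess is a sum over scales of averages of deficits along a segment; summing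
   over the lattice points of a cube, the translations are absorbed by a larger one. *)
Lemma sum_excess_zbox N n q (c c' : 'rV[int]_k) b b' : (q + n <= N)%N ->
  (forall w j, w \in zbox c b -> (j < 2 ^ (N - q))%N -> w + v *+ j \in zbox c' b') ->
  \sum_(w <- zbox c b) excess n q (gridpt N w) <=
  \sum_(q <= l < q + n) \sum_(w <- zbox c' b') deficit l (gridpt N w).
Proof.
move=> qnN cc'.
under eq_bigr => w _ do rewrite excessE.
rewrite exchange_big /= big_nat_shift.
apply: ler_sum => l _; rewrite -mulr_suml exchange_big /= ler_pdivrMr ?exprn_gt0//.
have -> : (\sum_(w <- zbox c' b') deficit (q + l) (gridpt N w)) * 2 ^+ l =
  \sum_(s < 2 ^ l) \sum_(w <- zbox c' b') deficit (q + l) (gridpt N w).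
  by rewrite sumr_const card_ord -[_ *+ (2 ^ l)]mulr_natr natrX.
apply: ler_sum => s _.
have lqN : (q + l <= N)%N by have := ltn_ord l; lia.
under eq_bigr => w _ do rewrite -(gridpt_refine R v lqN) -gridptZ -gridptD -mulrnA.
apply: (@sum_zbox_shift R k (fun w => deficit (q + l) (gridpt N w))).
  by move=> w; exact: deficit_ge0.
move=> w wc; apply: cc' => //.
rewrite (_ : N - q = N - (q + l) + l)%N; last by lia.
by rewrite expnD ltn_pmul2l ?expn_gt0.
Qed.

(** Half sides of windows that grow with the scale [l], by just enough to contain the
   translates of the previous window by [2^-(l+1) v]. *)
Definition window N M l := (2 ^ N * (M + 2 ^ t) - 2 ^ (N - l + t))%N.

Lemma windowS N M l : (l < N)%N -> (window N M l + 2 ^ (N - l.+1 + t) = window N M l.+1)%N.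
Proof.
move=> lN; rewrite /window (_ : N - l + t = (N - l.+1 + t).+1)%N; last by lia.
rewrite expnS; have : (2 ^ (N - l.+1 + t).+1 <= 2 ^ N * 2 ^ t)%N.
  by rewrite -expnD leq_exp2l//; lia.
rewrite expnS; move: (2 ^ (N - l.+1 + t))%N (2 ^ N)%N (2 ^ t)%N => a b c.
nia.
Qed.

Lemma energy_step N M l : (l < N)%N ->
  \sum_(w <- zbox 0 (window N M l)) deficit l (gridpt N w) +
  \sum_(w <- zbox 0 (window N M l)) speed l (gridpt N w) ^+ 2
  <= \sum_(w <- zbox 0 (window N M l.+1)) speed l.+1 (gridpt N w) ^+ 2.
Proof.
move=> lN; rewrite -big_split /=.
under eq_bigr => w _ do rewrite /deficit subrK.
rewrite -mulr_suml big_split /= ler_pdivrMr//.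
rewrite mulr_natr mulr2n lerD//.
  apply: ler_sum_uniq_sub; first exact: zbox_uniq.
    move=> w /mem_zboxP h; apply/mem_zboxP => i; apply: le_trans (h i) _.
    by rewrite lez_nat -windowS// leq_addr.
  by move=> w; exact: sqr_ge0.
under eq_bigr => w _ do rewrite -(gridpt_refine R v lN) -gridptD.
apply: (@sum_zbox_shift R k (fun w => speed l.+1 (gridpt N w) ^+ 2)).
  by move=> w; exact: sqr_ge0.
move=> w /mem_zboxP h; apply/mem_zboxP => i.
have := h i; rewrite !mxE mulmxnE !subr0 -windowS// PoszD => wi.
apply: le_trans (ler_normD _ _) _; rewrite lerD//.
rewrite normrMn -mulr_natr natz (addnC _ t) expnD PoszM ler_wpM2r//.
rewrite -(ler_int R) intr_norm.
have := le_trans (ler_rV_norm (gridpt 0 v) i) vt.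
by rewrite mxE expr0 divr1 => /le_trans; apply; rewrite -pmulrn natrX.
Qed.

(** The energy, the sum of the squared speeds over a window, increases with the scale
   by at least the sum of the deficits, and speeds are bounded: on a fixed window the
   deficits of all scales have a bounded sum, relative to the number of points. *)
Lemma energy_bound N M q : (q <= N)%N -> (0 < M)%N ->
  \sum_(l < q) \sum_(w <- zbox 0 (2 ^ N * M)) deficit l (gridpt N w) <=
  (Lam * 2 ^+ t) ^+ 2 * (3 * (M%:R + 2 ^+ t)) ^+ k * (2 ^+ N) ^+ k.
Proof.
move=> qN M0.
have w0 : window N M 0 = (2 ^ N * M)%N.
  by rewrite /window subn0 expnD mulnDr addnK.
have step : \sum_(l < q) \sum_(w <- zbox 0 (2 ^ N * M)) deficit l (gridpt N w) <=
    \sum_(w <- zbox 0 (window N M q)) speed q (gridpt N w) ^+ 2.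
  have window_le l l' : (l <= l')%N -> (window N M l <= window N M l')%N.
    move=> ll'; rewrite /window leq_sub2l// leq_exp2l//; lia.
  elim: q qN => [|q IH] qN.
    by rewrite big_ord0 sumr_ge0// => w _; exact: sqr_ge0.
  apply: le_trans (energy_step M qN); rewrite big_ord_recr /= addrC lerD ?IH ?(ltnW qN)//.
  apply: ler_sum_uniq_sub; first exact: zbox_uniq.
    move=> w /mem_zboxP h; apply/mem_zboxP => i; apply: le_trans (h i) _.
    by rewrite lez_nat -w0 window_le.
  by move=> w; exact: deficit_ge0.
apply: le_trans step _.
apply: (@le_trans _ _ (\sum_(w <- zbox (0 : 'rV[int]_k) (window N M q)) (Lam * 2 ^+ t) ^+ 2)).
  apply: ler_sum => w _; rewrite lerXn2r ?nnegrE ?speed_ge0 ?speed_le//.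
  by rewrite mulr_ge0 ?exprn_ge0.
rewrite big_const_seq count_predT iter_addr addr0 size_zbox -[leRHS]mulrA -[leLHS]mulr_natr.
rewrite ler_wpM2l ?sqr_ge0// -exprMn natrX lerXn2r ?nnegrE ?mulr_ge0 ?addr_ge0 ?exprn_ge0//.
rewrite -!natrX -natrD -!natrM ler_nat.
have : (0 < 2 ^ N)%N by rewrite expn_gt0.
rewrite /window; move: (2 ^ N)%N (2 ^ t)%N (2 ^ (N - q + t))%N => x y z x0; nia.
Qed.

(** The small cube is a fixed proportion of the large one, so that a bad cube forces a
   large sum of deficits; at which finer scale [q + n] it does so is arbitrary. *)
Definition bad_cube m (tau : R) q u := exists u' n,
  `|gridpt (q + m.+1) u' - gridpt q u| <= 3 / 2 ^+ q /\
  forall z, `|z - gridpt (q + m.+1) u'| <= 2 ^- (q + m.+1) -> tau <= excess n q z.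

(** All lattice points of the small cube have a large excess, and their number is a
   fixed fraction of the number of lattice points of the large one. *)
Lemma bad_cube_sum m (tau : R) q u n u' N : 0 <= tau -> (q + n <= N)%N -> (q + m.+1 <= N)%N ->
  `|gridpt (q + m.+1) u' - gridpt q u| <= 3 / 2 ^+ q ->
  (forall z, `|z - gridpt (q + m.+1) u'| <= 2 ^- (q + m.+1) -> tau <= excess n q z) ->
  tau * (half_side t.+3 q / 2 ^+ (t.+3 + m.+1)) ^+ k * (2 ^+ N) ^+ k <=
  \sum_(q <= l < q + n)
   \sum_(w <- zbox (u *+ 2 ^ (N - q)) (2 ^ (t.+3 + (N - q)))) deficit l (gridpt N w).
Proof.
move=> tau0 qnN qmN uu' bad.
pose c := u' *+ 2 ^ (N - (q + m.+1)); pose b := (2 ^ (N - (q + m.+1)))%N.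
have cE : gridpt N c = gridpt (q + m.+1) u' by exact: gridpt_refine.
have bE : b%:R / 2 ^+ N = 2 ^- (q + m.+1) :> R.
  rewrite /b natrX -{2}(subnK qmN) exprD.
  have : (2:R) ^+ (q + m.+1) != 0 by rewrite expf_neq0.
  have : (2:R) ^+ (N - (q + m.+1)) != 0 by rewrite expf_neq0.
  move: (2 ^+ (N - _)) (2 ^+ (q + _)) => x y x0 y0.
  by field; rewrite ?x0 ?y0.
have hole w : w \in zbox c b -> `|gridpt N w - gridpt (q + m.+1) u'| <= 2 ^- (q + m.+1).
  by move=> /(gridpt_zboxP R N); rewrite cE bE.
apply: le_trans (@sum_excess_zbox N n q c _ b _ qnN _); last first.
  move=> w j wc jN; apply/(gridpt_zboxP R N).
  have qN : (q <= N)%N by lia.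
  rewrite gridpt_refine// gridptD gridptZ.
  have -> : (2 ^ (t.+3 + (N - q)))%:R / 2 ^+ N = 8 * 2 ^+ t / 2 ^+ q :> R.
    rewrite natrX exprD -{2}(subnK qN) exprD.
    rewrite !exprS; have : (2:R) ^+ (N - q) != 0 by rewrite expf_neq0.
    have : (2:R) ^+ q != 0 by rewrite expf_neq0.
    by move: (2 ^+ (N - q)) (2 ^+ q) => x y x0 y0; field; rewrite x0.
  rewrite addrAC -[_ - gridpt q u](subrKA (gridpt (q + m.+1) u')).
  have h1 := hole _ wc.
  have h2 : `|j%:R *: gridpt N v| <= 2 ^+ t / 2 ^+ q.
    rewrite normrZ ger0_norm//; apply: (@le_trans _ _ (2 ^+ (N - q) * (2 ^+ t / 2 ^+ N))).
      apply: ler_pM => //; first by rewrite -natrX ler_nat ltnW.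
      exact: norm_gridpt_le.
    rewrite -{2}(subnK qN) exprD.
    have : (2:R) ^+ (N - q) != 0 by rewrite expf_neq0.
    have : (2:R) ^+ q != 0 by rewrite expf_neq0.
    move: (2 ^+ (N - q)) (2 ^+ q) => x y x0 y0.
    by rewrite le_eqVlt; apply/orP; left; apply/eqP; field; rewrite x0.
  have h3 : 2 ^- (q + m.+1) <= 1 / 2 ^+ q :> R.
    by rewrite div1r lef_pV2 ?posrE ?exprn_gt0// ler_weXn2l ?ler1n// leq_addr.
  have h4 : 1 <= 2 ^+ t :> R by rewrite exprn_ege1// ler1n.
  apply: le_trans (ler_normD _ _) _; apply: le_trans (lerD (ler_normD _ _) (lexx _)) _.
  have h5 : 1 / 2 ^+ q <= 2 ^+ t / 2 ^+ q :> R by rewrite ler_pM2r ?invr_gt0 ?exprn_gt0.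
  have := lerD (lerD (le_trans h1 h3) uu') h2; move/le_trans; apply.
  have h6 : 0 <= 2 ^- q :> R by rewrite invr_ge0 exprn_ge0.
  move: h5 h6; rewrite div1r -(mulrA 8); move: (2 ^- q) (2 ^+ t / 2 ^+ q) => x y; lra.
apply: (@le_trans _ _ (\sum_(w <- zbox c b) tau)); last first.
  by rewrite big_seq [leRHS]big_seq; apply: ler_sum => w /hole; exact: bad.
rewrite big_const_seq count_predT iter_addr addr0 size_zbox -[leRHS]mulr_natr -[leLHS]mulrA.
have r0 : 0 <= half_side t.+3 q / 2 ^+ (t.+3 + m.+1) * 2 ^+ N.
  by apply: mulr_ge0; [apply: divr_ge0; [exact: ltW (half_side_gt0 _ _ _)|]|]; exact: exprn_ge0.
rewrite ler_wpM2l// -exprMn natrX lerXn2r ?nnegrE//.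
rewrite /half_side.
have -> : 2 ^+ t.+3 / 2 ^+ q / 2 ^+ (t.+3 + m.+1) * 2 ^+ N = b%:R :> R.
  rewrite /b natrX -{1}(subnK qmN) !exprD.
  have : (2:R) ^+ q != 0 by rewrite expf_neq0.
  have : (2:R) ^+ m.+1 != 0 by rewrite expf_neq0.
  have : (2:R) ^+ t.+3 != 0 by rewrite expf_neq0.
  move: (2 ^+ q) (2 ^+ m.+1) (2 ^+ t.+3) (2 ^+ (N - (q + m.+1))) => x y z ? x0 y0 z0.
  by field; rewrite x0 y0.
by rewrite ler_nat -addnn -addnS leq_addr.
Qed.

Definition bad_family m (tau : R) M q0 (D : seq (nat * 'rV[int]_k)) :=
  [/\ uniq D, forall i, i \in D -> (q0 <= i.1)%N /\ bad_cube m tau i.1 i.2,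
      forall i, i \in D -> `|gridpt i.1 i.2| <= M%:R &
      forall i j, i \in D -> j \in D -> i != j -> ~ meets t.+3 i j].

(** Each round of disjoint bad cubes at finer scales adds a fixed amount to
   the energy, which is bounded: the volumes of bad families tend to zero. *)
Lemma bad_family_small m (tau : R) M (eta : R) : 0 < tau -> 0 < eta -> (0 < M)%N ->
  exists q0, forall D, bad_family m tau M q0 D -> \sum_(i <- D) half_side t.+3 i.1 ^+ k <= eta.
Proof.
move=> tau0 eta0 M0; apply: contrapT => /forallNP noq.
have {}noq q0 : exists2 D, bad_family m tau M q0 D & eta < \sum_(i <- D) half_side t.+3 i.1 ^+ k.
  by have /existsNP[D /not_implyP[Dbad /negP]] := noq q0; rewrite -ltNge; exists D.
pose c := tau * eta / (2 ^+ (t.+3 + m.+1)) ^+ k.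
have c0 : 0 < c by rewrite divr_gt0 ?mulr_gt0// !exprn_gt0.
pose MM := (M + 2 ^ t.+3)%N.
have round P : exists q, forall N, (q <= N)%N -> P%:R * c * (2 ^+ N) ^+ k <=
    \sum_(0 <= l < q) \sum_(w <- zbox 0 (2 ^ N * MM)) deficit l (gridpt N w).
  elim: P => [|P [q IH]].
    by exists 0%N => N _; rewrite big_geq// !mul0r.
  have [D [uD Dbad DM Ddisj] Deta] := noq q.
  have /choice[un unP] : forall i, exists un : 'rV[int]_k * nat, i \in D ->
      `|gridpt (i.1 + m.+1) un.1 - gridpt i.1 i.2| <= 3 / 2 ^+ i.1 /\
      forall z, `|z - gridpt (i.1 + m.+1) un.1| <= 2 ^- (i.1 + m.+1) ->
        tau <= excess un.2 i.1 z.
    move=> i; case: (boolP (i \in D)) => iD; last by exists (0, 0%N).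
    by have [_ [u' [n h]]] := Dbad _ iD; exists (u', n).
  pose q' := maxn q (\max_(i <- D) maxn (i.1 + (un i).2) (i.1 + m.+1)).
  have qq' : (q <= q')%N by exact: leq_maxl.
  have q'D i : i \in D -> (i.1 + (un i).2 <= q')%N /\ (i.1 + m.+1 <= q')%N.
    move=> iD; have : (maxn (i.1 + (un i).2) (i.1 + m.+1) <= q')%N.
      apply: leq_trans (leq_maxr _ _).
      exact: (@leq_bigmax_seq _ _ xpredT (fun i => maxn (i.1 + (un i).2) (i.1 + m.+1))).
    by rewrite geq_max => /andP[].
  exists q' => N q'N; rewrite (big_cat_nat (n := q))//=.
  rewrite -natr1 !mulrDl mul1r lerD// ?IH ?(leq_trans qq' q'N)//.
  rewrite exchange_big /=.
  have sd := @sum_disjoint_zbox R k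
    (fun w => \sum_(q <= l < q') deficit l (gridpt N w)) D t.+3 N M (2 ^ t.+3) _ uD _ _ Ddisj.
  apply: (le_trans _ (sd _ _ _)); last 3 first.
  - by move=> w; apply: sumr_ge0 => l _; exact: deficit_ge0.
  - by move=> i /q'D[/(leq_trans (leq_addr _ _)) h _]; exact: leq_trans q'N.
  - by move=> i iD; rewrite DM// half_side_le.
  apply: (@le_trans _ _ (\sum_(i <- D)
      tau * (half_side t.+3 i.1 / 2 ^+ (t.+3 + m.+1)) ^+ k * (2 ^+ N) ^+ k)).
    rewrite -mulr_suml ler_wpM2r ?exprn_ge0// -mulr_sumr /c.
    under eq_bigr => i _ do rewrite expr_div_n.
    rewrite -mulr_suml -[leLHS]mulrA ler_pM2l// ler_pM2r ?invr_gt0 ?exprn_gt0//.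
    exact: ltW.
  rewrite big_seq [leRHS]big_seq; apply: ler_sum => i iD.
  have [h1 h2] := unP _ iD; have [h3 h4] := q'D _ iD.
  apply: (le_trans (@bad_cube_sum m tau _ _ _ _ N (ltW tau0) _ _ h1 h2)); [exact: leq_trans h3 q'N|exact: leq_trans h4 q'N|].
  rewrite [leRHS]exchange_big /=.
  have [qi _] := Dbad _ iD.
  rewrite [leRHS](big_cat_nat (n := i.1))//=; last exact: leq_trans (leq_addr _ _) h3.
  rewrite [X in _ <= _ + X](big_cat_nat (n := (i.1 + (un i).2)%N))//=; last exact: leq_addr.
  rewrite addrCA lerDl addr_ge0//; apply: sumr_ge0 => l _; apply: sumr_ge0 => w _;
  exact: deficit_ge0.
pose C := (Lam * 2 ^+ t) ^+ 2 * (3 * (MM%:R + 2 ^+ t)) ^+ k.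
have bound P : P%:R * c <= C.
  have [q /(_ q (leqnn _))] := round P.
  rewrite big_mkord => /le_trans/(_ (energy_bound (leqnn q) _)).
  by rewrite ler_pM2r ?exprn_gt0//; apply; rewrite /MM addn_gt0 M0.
have := bound (Num.truncn (C / c)).+1.
rewrite -ler_pdivlMr// leNgt => /negP; apply.
exact: truncnS_gt.
Qed.

(** Points that lie near bad cubes at infinitely many scales are covered by a
   disjoint bad family of fine scales, enlarged by a constant factor. *)
Lemma bad_null m (tau : R) M : (0 < k)%N -> 0 < tau -> (0 < M)%N ->
  null (fun x y => `|x - y|) k [set x | `|x| + 1 <= M%:R /\
    forall q0, exists q u, [/\ (q0 <= q)%N, `|gridpt q u - x| <= 2 ^- q &
      bad_cube m tau q u]].
Proof.
move=> k0 tau0 M0 eta eta0.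
have eta6 : 0 < eta / 6 ^+ k by rewrite divr_gt0// exprn_gt0.
have [q0 q0P] := bad_family_small m tau0 eta6 M0.
pose V := [set i : nat * 'rV[int]_k | [/\ (q0 <= i.1)%N, `|gridpt i.1 i.2| <= M%:R &
  bad_cube m tau i.1 i.2]].
have [D DV [Ddisj Dmax]] := @greedy_selection _ (fun i : nat * 'rV[int]_k => i.1)
  (meets t.+3) V (@meetsC R k t.+3).
apply: (@small_cover_count _ _ _ _ k0 _
  (fun i => [set x | D i /\ `|x - gridpt i.1 i.2| <= 3 * half_side t.+3 i.1])
  (fun i => if `[< D i >] then 6 * half_side t.+3 i.1 else 0)).
- move=> x /= [xM /(_ q0)[q [u [q0q ux uq]]]].
  have q1 : 2 ^- q <= 1 :> R by rewrite invf_le1 ?exprn_gt0// exprn_ege1// ler1n.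
  have Vqu : V (q, u).
    split=> //=; rewrite -[gridpt q u](subrK x).
    by apply: le_trans (ler_normD _ _) _; rewrite addrC; move: ux q1 xM; lra.
  have [j [Dj /= jq jqu]] := Dmax _ Vqu; exists j => //=; split=> //.
  have rq : half_side t.+3 q <= half_side t.+3 j.1.
    rewrite /half_side ler_pM2l ?exprn_gt0// lef_pV2 ?posrE ?exprn_gt0//.
    by rewrite ler_weXn2l// ler1n.
  have qr : 2 ^- q <= half_side t.+3 q.
    by rewrite /half_side ler_peMl ?invr_ge0 ?exprn_ge0// exprn_ege1// ler1n.
  have cc : `|gridpt q u - gridpt j.1 j.2| <= 2 * half_side t.+3 j.1.
    case: jqu => [->/=|]; first by rewrite subrr normr0 mulr_ge0// ltW// half_side_gt0.
    by rewrite /meets /= distrC; move: rq; lra.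
  rewrite -[_ - _](subrKA (gridpt q u)); apply: le_trans (ler_normD _ _) _.
  by move: ux; rewrite distrC; lra.
- by move=> i; case: ifP => // _; rewrite mulr_ge0// ltW// half_side_gt0.
- move=> i x y [Di xi] [_ yi]; rewrite asboolT//.
  rewrite -[_ - _](subrKA (gridpt i.1 i.2)); apply: le_trans (ler_normD _ _) _.
  by move: xi yi; rewrite [X in _ -> X <= _ -> _]distrC; lra.
- move=> s us.
  have -> : \sum_(i <- s) (if `[< D i >] then 6 * half_side t.+3 i.1 else 0) ^+ k =
     6 ^+ k * \sum_(i <- [seq i <- s | `[< D i >]]) half_side t.+3 i.1 ^+ k.
    rewrite big_filter mulr_sumr [RHS]big_mkcond /=; apply: eq_bigr => i _.
    by case: ifP => _; rewrite ?exprMn// expr0n eqn0Ngt k0.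
  rewrite mulrC -ler_pdivlMr ?exprn_gt0//; apply: q0P; split.
  - exact: filter_uniq.
  - by move=> i; rewrite mem_filter => /andP[/asboolP/DV[]].
  - by move=> i; rewrite mem_filter => /andP[/asboolP/DV[]].
  - move=> i j; rewrite !mem_filter => /andP[/asboolP Di _] /andP[/asboolP Dj _].
    exact: Ddisj.
Qed.

End energy.

(** * Thin directions *)

Section thin.
Variables (R : realType) (k : nat) (Lam K : R).
Variables (rho rhof : 'rV[R]_k -> 'rV[R]_k -> R).
Hypothesis Lam_ge0 : 0 <= Lam.
Hypotheses (rhoP : lip_pmetric Lam rho) (rhofP : lip_pmetric Lam rhof).
Hypothesis rhof_le : forall (z g : 'rV[R]_k) (S : R),
  (forall n, \sum_(s < 2 ^ n) rho (z + (s%:R / 2 ^+ n) *: g)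
                                  (z + (s.+1%:R / 2 ^+ n) *: g) <= S) ->
  forall tau : R, 0 <= tau <= 1 -> rhof z (z + tau *: g) <= K * S.
Local Notation gridpt := (@gridpt R k).
Local Notation half_side := (@half_side R).
Local Notation meets := (@meets R k).
Implicit Types (x y z : 'rV[R]_k) (l n q N m p j : nat) (u w v : 'rV[int]_k).

Lemma speed_continuous v l : continuous (speed rho v l).
Proof.
move=> x; apply/(@cvgrPdist_le _ _ _ (nbhs x)) => e e0.
pose C := 2 * Lam * 2 ^+ l + 1.
have C0 : 0 < C by rewrite /C ltr_wpDl// mulr_ge0 ?mulr_ge0 ?exprn_ge0.
near=> y; apply: le_trans (speed_lip rhoP v l x y) _.
have xy : `|x - y| <= e / C.
  near: y; apply/nbhs_ballP; exists (e / C); first by rewrite /= divr_gt0.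
  by move=> y; rewrite -ball_normE /= => /ltW.
apply: (@le_trans _ _ (C * `|x - y|)); first by rewrite ler_wpM2r// /C lerDl.
by rewrite mulrC -ler_pdivlMr.
Unshelve. all: by end_near. Qed.

Lemma excess_continuous v n q : continuous (excess rho v n q).
Proof.
have sq_cont (f : 'rV[R]_k -> R) : continuous f -> continuous (fun z => f z ^+ 2).
  move=> cf z; rewrite (_ : (fun z => _) = (fun z => f z * f z)).
    exact: (continuousM (cf z) (cf z)).
  by apply/funext => y; rewrite expr2.
have sum_cont a (f : nat -> 'rV[R]_k -> R) : (forall s, continuous (f s)) ->
    continuous (fun z => \sum_(s < a) f s z).
  move=> cf; elim: a => [|a IH] z.
    rewrite (_ : (fun z => _) = (fun=> 0)); last by apply/funext => y; rewrite big_ord0.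
    exact: cst_continuous.
  rewrite (_ : (fun z => _) = (fun z => \sum_(s < a) f s z + f a z)).
    exact: (continuousD (IH z) (cf a z)).
  by apply/funext => y; rewrite big_ord_recr.
pose shift a z := z + a%:R *: gridpt (q + n) v : 'rV[R]_k.
have shift_cont a : continuous (shift a).
  move=> z; apply: (@continuousD _ _ _ id (cst (a%:R *: gridpt (q + n) v))).
    exact: cvg_id.
  exact: cst_continuous.
pose S z := \sum_(a < 2 ^ n) speed rho v (q + n) (shift a z) ^+ 2.
have S_cont : continuous S.
  apply: (sum_cont _ (fun a z => speed rho v (q + n) (shift a z) ^+ 2)) => a.
  apply: (sq_cont (speed rho v (q + n) \o shift a)) => z.
  exact: (continuous_comp (shift_cont a z) (@speed_continuous _ _ _)).
move=> z; apply: (@continuousB _ _ _ (fun z => S z * 2 ^- n) (fun z => speed rho v q z ^+ 2)).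
  exact: (continuousM (S_cont z) (@cst_continuous _ _ _ _)).
exact: (sq_cont _ (@speed_continuous v q)).
Qed.

(** Near a point of a cube that is not bad, some segment has small excess at all
   finer scales simultaneously; compactness yields it from one scale at a time. *)
Lemma good_start v m q u tau x z :
  ~ bad_cube rho v m tau q u -> `|gridpt q u - x| <= 2 ^- q -> `|z - x| <= 2 ^- q ->
  exists z', `|z' - z| <= 2 ^- (q + m) /\ forall n, excess rho v n q z' <= tau.
Proof.
move=> nbad ux zx; have [u' u'z] := gridpt_near (q + m.+1) z.
have h1 : 2 ^- (q + m.+1) <= 2 ^- q :> R.
  by rewrite lef_pV2 ?posrE ?exprn_gt0// ler_weXn2l ?ler1n// leq_addr.
have uu' : `|gridpt (q + m.+1) u' - gridpt q u| <= 3 / 2 ^+ q.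
  rewrite -[_ - _](subrKA z); apply: le_trans (ler_normD _ _) _.
  rewrite -[z - gridpt q u](subrKA x).
  apply: le_trans (lerD (lexx _) (ler_normD _ _)) _.
  move: ux u'z; rewrite [in X in X -> _]distrC; lra.
set c := gridpt (q + m.+1) u' in u'z uu'.
pose B := [set y : 'rV[R]_k | `|y - c| <= 2 ^- (q + m.+1)].
have /choice[zn znP] n : exists z', B z' /\ excess rho v n q z' <= tau.
  apply: contrapT => /forallNP h; apply: nbad; exists u', n; split=> // y yB.
  by have /not_andP[//|/negP] := h y; rewrite -ltNge => /ltW.
have Bcompact : compact B.
  apply: bounded_closed_compact.
    exists (`|c| + 2 ^- (q + m.+1)); split; first exact: num_real.
    move=> M cM y /= yB; apply: ltW; apply: le_lt_trans cM.
    by rewrite -[y](subrK c) addrC; apply: le_trans (ler_normD _ _) _; rewrite lerD2l.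
  rewrite (_ : B = closed_ball c (2 ^- (q + m.+1))); first exact: closed_ball_closed.
  rewrite closed_ballE ?invr_gt0 ?exprn_gt0//.
  by apply/seteqP; split=> y; rewrite /B /closed_ball_ /= distrC.
have [|z' [z'B z'cl]] := Bcompact (zn @ \oo) _.
  by exists 0%N => // n _; have [] := znP n.
exists z'; split=> [|n].
  rewrite -[z' - z](subrKA c); apply: le_trans (ler_normD _ _) _.
  have -> : 2 ^- (q + m) = 2 ^- (q + m.+1) + 2 ^- (q + m.+1) :> R.
    rewrite addnS exprS; have : (2:R) ^+ (q + m) != 0 by rewrite expf_neq0.
    by move: (2 ^+ _) => a a0; field.
  exact: lerD.
rewrite leNgt; apply/negP => lt_tau.
have [||y [[n' nn' <-] /=]] := z'cl [set zn n' | n' in [set n' | (n <= n')%N]]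
  [set y | tau < excess rho v n q y].
- exists n => // n' /= nn'; by exists n'.
- have := @excess_continuous v n q z' => /cvgrPdist_lt/(_ (excess rho v n q z' - tau)).
  rewrite subr_gt0 => /(_ lt_tau); apply: filterS => y /=.
  by rewrite ltr_norml => /andP[_]; lra.
apply/negP; rewrite -leNgt.
by apply: le_trans (excess_le rhoP v q _ nn') _; have [] := znP n'.
Qed.

(** A bound on the mean square deviation of the speeds on [2^m 2^n] pieces bounds their
   sum on the first [2^n] of them, which bounds the length of this part. *)
Lemma good_segment v m q z :
  (forall n, excess rho v n q z <= 2 ^- m) -> forall n,
  \sum_(s < 2 ^ n) rho (z + (s%:R / 2 ^+ n) *: gridpt (q + m) v)
                       (z + (s.+1%:R / 2 ^+ n) *: gridpt (q + m) v)
  <= (speed rho v q z + 1) / 2 ^+ (q + m).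
Proof.
move=> ez n; have rho0 := lpm_ge0 rhoP.
pose c := speed rho v q z.
pose b s := speed rho v (q + (m + n)) (z + s%:R *: gridpt (q + (m + n)) v).
have gE : 2 ^- n *: gridpt (q + m) v = gridpt (q + (m + n)) v.
  by rewrite !(gridpt_scale _ (q + _)) scalerA addnA [in RHS]exprD invfM mulrC.
have bE s : rho (z + (s%:R / 2 ^+ n) *: gridpt (q + m) v)
                (z + (s.+1%:R / 2 ^+ n) *: gridpt (q + m) v) = b s / 2 ^+ (q + (m + n)).
  rewrite -!scalerA gE /b /speed -[s.+1]addn1 natrD scalerDl scale1r addrA.
  by rewrite mulrAC divff ?mul1r// expf_neq0.
under eq_bigr => s _ do rewrite bE.
rewrite -mulr_suml ler_pdivrMr ?exprn_gt0//.
have var : \sum_(s < 2 ^ n) (b s - c) ^+ 2 <= 2 ^+ n.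
  apply: (@le_trans _ _ (\sum_(s < 2 ^ (m + n)) (b s - c) ^+ 2)).
    rewrite -!(big_mkord xpredT (fun s => (b s - c) ^+ 2)).
    rewrite [leRHS](@big_cat_nat _ _ _ (2 ^ n))//=; last by rewrite leq_exp2l// leq_addl.
    by rewrite lerDl sumr_ge0// => s _; exact: sqr_ge0.
  apply: le_trans (excess_variance rhoP v (m + n) q z) _.
  apply: (@le_trans _ _ (2 ^+ (m + n) * 2 ^- m)); first by rewrite ler_pM2l ?exprn_gt0.
  by rewrite exprD mulrAC divff ?mul1r// expf_neq0.
have -> : (c + 1) / 2 ^+ (q + m) * 2 ^+ (q + (m + n)) = (c + 1) * 2 ^+ n.
  rewrite addnA (exprD _ (q + m)); have : (2:R) ^+ (q + m) != 0 by rewrite expf_neq0.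
  by move: (2 ^+ (q + m)) => a a0; field.
apply: (@le_trans _ _ (\sum_(s < 2 ^ n) (c + ((b s - c) ^+ 2 + 1) / 2))).
  by apply: ler_sum => s _; have := sqr_ge0 (b s - c - 1); rewrite !expr2; lra.
have -> : \sum_(s < 2 ^ n) (c + ((b s - c) ^+ 2 + 1) / 2) =
    (c + 1 / 2) * 2 ^+ n + (\sum_(s < 2 ^ n) (b s - c) ^+ 2) / 2.
  rewrite (eq_bigr (fun s : 'I_(2 ^ n) => (c + 1 / 2) + (b s - c) ^+ 2 / 2)); last first.
    by move=> s _; field.
  by rewrite big_split /= sumr_const card_ord mulr_suml -[_ *+ _]mulr_natr natrX.
move: var; move: (\sum_(s < _) _) => S var; rewrite !mulrDl mul1r; lra.
Qed.

(** If [rho] is nearly degenerate along [v] from one point [x], at scale [j], the small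
   excess at the coarser scale [q] spreads this to a whole cube: nearby segments have
   comparable speeds at scale [q], hence small lengths, and these bound [rhof]. *)
Lemma thin_direction v p j q u x z (tau : R) :
  `|gridpt 0 v| <= 2 ^+ p.+1 -> j = (q + p.+2)%N ->
  speed rho v j x <= Lam + 2 ->
  ~ bad_cube rho v p.+2 (2 ^- p.+2) q u -> `|gridpt q u - x| <= 2 ^- q ->
  `|z - x| <= 2 ^+ p / 2 ^+ j -> 0 <= tau <= 1 ->
  rhof z (z + tau *: gridpt j v) <= (K * (5 * Lam + 4) + 2 * Lam) / 2 ^+ j.
Proof.
move=> vt jE sjx nbad ux zx tau01.
have J0 : 0 < 2 ^+ j :> R by rewrite exprn_gt0.
have JE : 2 ^+ j = 4 * 2 ^+ p * 2 ^+ q :> R.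
  by rewrite jE exprD !exprS; ring.
have P1 : 1 <= 2 ^+ p :> R by rewrite exprn_ege1// ler1n.
have Q0 : 0 < 2 ^+ q :> R by rewrite exprn_gt0.
have zxq : `|z - x| <= 2 ^- q.
  apply: le_trans zx _; rewrite JE ler_pdivrMr; last by rewrite !mulr_gt0//; lra.
  by rewrite mulrCA mulVf ?gt_eqF//; lra.
have [x' [x'x ex']] : exists z', `|z' - x| <= 2 ^- (q + p.+2) /\
    forall n, excess rho v n q z' <= 2 ^- p.+2.
  by apply: good_start nbad ux _; rewrite subrr normr0 invr_ge0 exprn_ge0.
have [z' [z'z ez']] := good_start nbad ux zxq.
rewrite -jE in x'x z'z.
have sjx' : speed rho v j x' <= 3 * Lam + 2.
  have := speed_lip rhoP v j x' x; rewrite ler_norml => /andP[_].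
  have : 2 * Lam * 2 ^+ j * `|x' - x| <= 2 * Lam.
    rewrite -mulrA -[leRHS]mulr1 ler_wpM2l ?mulr_ge0//.
    by rewrite mulrC -ler_pdivlMr// div1r.
  lra.
(* The first of the [2^(p+2)] pieces of the segment from [x'] already has about the
   speed of the whole segment. *)
have sqx' : speed rho v q x' <= 3 * Lam + 3.
  have := excess_variance rhoP v p.+2 q x'; rewrite -jE => var.
  have {var} : (speed rho v j x' - speed rho v q x') ^+ 2 <= 1.
    apply: (@le_trans _ _ (2 ^+ p.+2 * excess rho v p.+2 q x')).
      apply: le_trans var; rewrite -(big_mkord xpredT (fun s =>
        (speed rho v j (x' + s%:R *: gridpt j v) - speed rho v q x') ^+ 2)).
      rewrite big_ltn ?expn_gt0// scale0r addr0 lerDl sumr_ge0// => s _.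
      exact: sqr_ge0.
    apply: (@le_trans _ _ (2 ^+ p.+2 * 2 ^- p.+2)); first by rewrite ler_pM2l ?exprn_gt0.
    by rewrite divff ?expf_neq0.
  by rewrite -real_normK ?num_real// expr_le1// ler_norml => /andP[]; lra.
have sqz' : speed rho v q z' <= 5 * Lam + 3.
  have := speed_lip rhoP v q z' x'; rewrite ler_norml => /andP[_].
  have : 2 * Lam * 2 ^+ q * `|z' - x'| <= 2 * Lam.
    rewrite -mulrA -[leRHS]mulr1 ler_wpM2l ?mulr_ge0//.
    have : `|z' - x'| <= (2 ^+ p + 2) / 2 ^+ j.
      rewrite -[z' - x'](subrKA z); apply: le_trans (ler_normD _ _) _.
      rewrite -[z - x'](subrKA x); apply: le_trans (lerD (lexx _) (ler_normD _ _)) _.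
      by move: x'x; rewrite distrC mulrDl; lra.
    move=> /(ler_wpM2l (ltW Q0))/le_trans; apply.
    by rewrite mulrA ler_pdivrMr// mul1r JE mulrC ler_pM2r//; lra.
  lra.
have rz' : rhof z' (z' + tau *: gridpt j v) <= K * ((5 * Lam + 4) / 2 ^+ j).
  apply: rhof_le tau01 => n.
  have := good_segment ez' n; rewrite -jE => /le_trans; apply.
  by rewrite ler_pM2r ?invr_gt0//; lra.
have tri := lpm_tri rhofP.
have := tri z' z (z + tau *: gridpt j v).
have := tri (z' + tau *: gridpt j v) z' (z + tau *: gridpt j v).
have l1 := lpm_lip rhofP z z'; have := lpm_lip rhofP (z' + tau *: gridpt j v) (z + tau *: gridpt j v).
rewrite opprD addrACA subrr addr0 => l2.
have l3 : Lam * `|z' - z| <= Lam / 2 ^+ j by rewrite ler_wpM2l.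
rewrite distrC in l1; rewrite mulrDl -!mulrA; lra.
Qed.

End thin.

(** * Transfer of null sets *)

Section transfer.
Variables (R : realType) (k' : nat) (Lam K : R).
Local Notation k := k'.+1.
Variables (rho rhof : 'rV[R]_k -> 'rV[R]_k -> R).
Hypotheses (Lam_ge0 : 0 <= Lam) (K_ge0 : 0 <= K).
Hypotheses (rhoP : lip_pmetric Lam rho) (rhofP : lip_pmetric Lam rhof).
Hypothesis rhof_le : forall (z g : 'rV[R]_k) (S : R),
  (forall n, \sum_(s < 2 ^ n) rho (z + (s%:R / 2 ^+ n) *: g)
                                  (z + (s.+1%:R / 2 ^+ n) *: g) <= S) ->
  forall tau : R, 0 <= tau <= 1 -> rhof z (z + tau *: g) <= K * S.
Local Notation gridpt := (@gridpt R k).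
Local Notation half_side := (@half_side R).
Local Notation meets := (@meets R k).
Implicit Types (x y z : 'rV[R]_k) (l n q N m p j s : nat) (u w v : 'rV[int]_k).

Definition thin s j w (c : R) :=
  exists U : {ffun 'I_k' -> 'I_(2 ^ s.+4.+1)} -> set 'rV[R]_k,
    [set z | `|z - gridpt j w| <= 4 * half_side s j] `<=` \bigcup_phi U phi /\
    forall phi z1 z2, U phi z1 -> U phi z2 -> rhof z1 z2 <= c / 2 ^+ j.

(** A cube on which [rhof] is degenerate along [v] is covered by tubes parallel to
   [v]: their number is a power with exponent [k - 1] of the relative width. *)
Lemma thin_cover v s j w c i0 :
  `|gridpt 0 v| <= 2 ^+ s.+4.+1 -> 2 ^+ s.+4 <= `|(v ord0 i0)%:~R : R| ->
  (forall z (tau : R), `|z - gridpt j w| <= 4 * half_side s j -> 0 <= tau <= 1 ->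
     rhof z (z + tau *: gridpt j v) <= c / 2 ^+ j) ->
  thin s j w (c + Lam).
Proof.
move=> vt v0 deg; set c0 := gridpt j w.
pose V0 : R := (v ord0 i0)%:~R.
have P0 : 0 < 2 ^+ s :> R by rewrite exprn_gt0.
have J0 : 0 < 2 ^+ j :> R by rewrite exprn_gt0.
have PE : 2 ^+ s.+4 = 16 * 2 ^+ s :> R by rewrite !exprS; ring.
have V00 : 0 < `|V0| by apply: lt_le_trans v0; rewrite exprn_gt0.
have V0n : V0 != 0 by rewrite -normr_gt0.
pose r i : R := (v ord0 i)%:~R / V0.
have r2 i : `|r i| <= 2.
  rewrite /r normrM normfV ler_pdivrMr//.
  have := le_trans (ler_rV_norm (gridpt 0 v) i) vt; rewrite mxE expr0 divr1.
  by move=> /le_trans; apply; rewrite exprS ler_pM2l.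
pose g i z : R := (z - c0) ord0 i - (z - c0) ord0 i0 * r i.
pose num i z := Num.truncn (2 ^+ j * g (lift i0 i) z + 12 * 2 ^+ s).
have num_ge0 i z : `|z - c0| <= 4 * half_side s j ->
    0 <= 2 ^+ j * g (lift i0 i) z + 12 * 2 ^+ s < 32 * 2 ^+ s.
  move=> zc; have z1 := le_trans (ler_rV_norm (z - c0) (lift i0 i)) zc.
  have z2 := le_trans (ler_rV_norm (z - c0) i0) zc.
  have z3 : `|(z - c0) ord0 i0 * r (lift i0 i)| <= 8 * half_side s j.
    rewrite normrM (_ : 8 = 4 * 2); last by ring.
    by rewrite mulrAC; apply: ler_pM.
  have gz : `|g (lift i0 i) z| <= 12 * half_side s j.
    by apply: le_trans (ler_normB _ _) _; lra.
  have : `|2 ^+ j * g (lift i0 i) z| <= 12 * 2 ^+ s.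
    rewrite normrM gtr0_norm//; apply: le_trans (ler_wpM2l (ltW J0) gz) _.
    by rewrite /half_side le_eqVlt; apply/orP; left; apply/eqP; field; rewrite gt_eqF.
  by rewrite ler_norml => /andP[]; lra.
exists (fun phi : {ffun 'I_k' -> 'I_(2 ^ s.+4.+1)} =>
  [set z | `|z - c0| <= 4 * half_side s j /\ forall i, num i z = phi i]).
split=> [z /= zc|phi].
  have h i : (num i z < 2 ^ s.+4.+1)%N.
    have /andP[n0 n1] := num_ge0 i z zc.
    by rewrite truncn_lt_nat// natrX exprS PE; lra.
  by exists [ffun i => Ordinal (h i)] => //; split=> // i; rewrite ffunE.
have H z1 z2 : `|z1 - c0| <= 4 * half_side s j -> `|z2 - c0| <= 4 * half_side s j ->
    (forall i, num i z1 = phi i) -> (forall i, num i z2 = phi i) ->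
    0 <= (z2 - z1) ord0 i0 * 2 ^+ j / V0 -> rhof z1 z2 <= (c + Lam) / 2 ^+ j.
  move=> z1c z2c n1 n2; set tau := _ / V0 => tau0.
  have z12 : `|z2 - z1| <= 8 * half_side s j.
    rewrite -[z2 - z1](subrKA c0); apply: le_trans (ler_normD _ _) _.
    by rewrite (distrC c0); lra.
  have tau1 : tau <= 1.
    apply: le_trans (ler_norm _) _; rewrite /tau normrM normfV ler_pdivrMr// mul1r.
    rewrite normrM [`|2 ^+ j|]gtr0_norm//.
    apply: le_trans v0; rewrite PE.
    apply: le_trans (ler_wpM2r (ltW J0) (le_trans (ler_rV_norm _ _) z12)) _.
    by rewrite /half_side mulrA divfK ?gt_eqF//; move: P0; lra.
  apply: le_trans (lpm_tri rhofP (z1 + tau *: gridpt j v) _ _) _.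
  rewrite mulrDl lerD ?deg ?tau0 ?tau1//.
  apply: le_trans (lpm_lip rhofP _ _) _; rewrite ler_wpM2l//.
  apply/rV_norm_leP => [|i]; first by rewrite invr_ge0 ltW.
  have -> : (z1 + tau *: gridpt j v - z2) ord0 i =
      (z1 - z2) ord0 i + (z2 - z1) ord0 i0 * r i.
    by rewrite /tau /r !mxE; field; rewrite V0n gt_eqF.
  case: (unliftP i0 i) => [i' ->|->]; last first.
    by rewrite /r divff// mulr1 !mxE addrA subrK subrr normr0 invr_ge0 ltW.
  have : num i' z1 = num i' z2 by rewrite n1 n2.
  rewrite {1}/num => nn.
  have /andP[a1 a2] := truncn_itv (andP (num_ge0 i' z1 z1c)).1.
  have /andP[a3 a4] := truncn_itv (andP (num_ge0 i' z2 z2c)).1.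
  rewrite nn in a1 a2; rewrite -/(num i' z2) in a3 a4.
  rewrite -natr1 in a2; rewrite -natr1 in a4.
  have -> : (z1 - z2) ord0 (lift i0 i') + (z2 - z1) ord0 i0 * r (lift i0 i') =
      g (lift i0 i') z1 - g (lift i0 i') z2.
    by rewrite /g !mxE; ring.
  rewrite -div1r ler_pdivlMr// -[X in _ * X]gtr0_norm// -normrM mulrC mulrBr.
  by rewrite ler_norml; lra.
move=> z1 z2 [z1c n1] [z2c n2].
have [|neg] := leP 0 ((z2 - z1) ord0 i0 * 2 ^+ j / V0); first exact: H.
rewrite (lpm_sym rhofP); apply: H => //.
by rewrite -opprB mxE !mulNr oppr_ge0 ltW.
Qed.

(** A tube cover of a cube of side about [2^(s-j)] costs [2^(s(k-1))] times [2^(-jk)],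
   a factor [2^-s] less than the volume of the cube; disjoint cubes in a bounded region
   have bounded total volume. *)
Lemma thin_small_cover (A : set 'rV[R]_k) M s (c : R) : 0 <= c -> (0 < M)%N ->
  (forall x, A x -> `|x| + 1 <= M%:R) ->
  (forall x, A x -> exists j w,
     [/\ (s <= j)%N, `|gridpt j w - x| <= 2 ^- j & thin s j w c]) ->
  small_cover rhof k A (32 ^+ k' * (3 * c * (M%:R + 1)) ^+ k / 2 ^+ s).
Proof.
move=> c0 M0 AM Athin.
pose V := [set i : nat * 'rV[int]_k | [/\ (s <= i.1)%N, `|gridpt i.1 i.2| <= M%:R &
  thin s i.1 i.2 c]].
have [D DV [Ddisj Dmax]] := @greedy_selection _ (fun i : nat * 'rV[int]_k => i.1)
  (meets s) V (@meetsC R k s).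
have /choice[U UP] : forall i : nat * 'rV[int]_k,
    exists U : {ffun 'I_k' -> 'I_(2 ^ s.+4.+1)} -> set 'rV[R]_k, D i ->
    [set z | `|z - gridpt i.1 i.2| <= 4 * half_side s i.1] `<=` \bigcup_phi U phi /\
    forall phi z1 z2, U phi z1 -> U phi z2 -> rhof z1 z2 <= c / 2 ^+ i.1.
  move=> i; have [Di|nDi] := pselect (D i); last by exists (fun=> set0).
  by have [_ _ [U UP]] := DV _ Di; exists U.
pose F : finType := {ffun 'I_k' -> 'I_(2 ^ s.+4.+1)}.
have d0 i : 0 <= c / 2 ^+ i by rewrite divr_ge0// exprn_ge0.
apply: (@small_cover_count _ _ _ k _ ((nat * 'rV[int]_k) * F)%type
  (fun i => [set z | D i.1 /\ U i.1 i.2 z])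
  (fun i => if `[< D i.1 >] then c / 2 ^+ i.1.1 else 0)) => //.
- move=> x Ax; have [j [w [sj wx jw]]] := Athin _ Ax.
  have j1 : 2 ^- j <= 1 :> R by rewrite invf_le1 ?exprn_gt0// exprn_ege1// ler1n.
  have Vjw : V (j, w).
    split=> //=; rewrite -[gridpt j w](subrK x).
    by apply: le_trans (ler_normD _ _) _; rewrite addrC; have := AM _ Ax; lra.
  have [i [Di /= ij iw]] := Dmax _ Vjw.
  have rj : half_side s j <= half_side s i.1.
    rewrite /half_side ler_pM2l ?exprn_gt0// lef_pV2 ?posrE ?exprn_gt0//.
    by rewrite ler_weXn2l// ler1n.
  have jr : 2 ^- j <= half_side s j.
    by rewrite /half_side ler_peMl ?invr_ge0 ?exprn_ge0// exprn_ege1// ler1n.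
  have cc : `|gridpt j w - gridpt i.1 i.2| <= 2 * half_side s i.1.
    case: iw => [->/=|]; first by rewrite subrr normr0 mulr_ge0// ltW// half_side_gt0.
    by rewrite /meets /= distrC; lra.
  have [iU _] := UP _ Di; have [|phi _ Ux] := iU x; last by exists (i, phi).
  rewrite /= -[_ - _](subrKA (gridpt j w)); apply: le_trans (ler_normD _ _) _.
  by rewrite distrC; have := half_side_gt0 R s i.1; lra.
- by move=> i; case: ifP.
- move=> [i phi] x y /= [Di xU] [_ yU]; rewrite asboolT//.
  by have [_] := UP _ Di; apply; eassumption.
- move=> S uS; pose L := undup [seq i.1 | i <- S].
  pose G i : R := (if `[< D i >] then c / 2 ^+ i.1 else 0) ^+ k.
  have G0 i : 0 <= G i by rewrite /G; apply: exprn_ge0; case: ifP.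
  apply: (@le_trans _ _ (\sum_(i <- [seq (i, phi) | i <- L, phi <- enum F]) G i.1)).
    apply: (@ler_sum_uniq_sub _ _ _ _ (fun i : (nat * 'rV[int]_k) * F => G i.1) uS) => //.
    move=> [i phi] iS; apply/allpairsP; exists (i, phi) => /=.
    by rewrite mem_undup mem_enum; split=> //; apply/mapP; exists (i, phi).
  rewrite big_allpairs /=.
  under eq_bigr => i _ do rewrite big_const_seq count_predT iter_addr addr0.
  rewrite -cardE card_ffun !card_ord sumrMnl -[leLHS]mulr_natl natrX.
  have -> : \sum_(i <- L) G i = (c / 2 ^+ s) ^+ k *
      \sum_(i <- [seq i <- L | `[< D i >]]) half_side s i.1 ^+ k.
    rewrite big_filter mulr_sumr [RHS]big_mkcond /=; apply: eq_bigr => i _.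
    rewrite /G; case: ifP => _; last by rewrite expr0n.
    rewrite -exprMn; congr (_ ^+ _); rewrite /half_side.
    by rewrite mulrA divfK// expf_neq0.
  have pack : \sum_(i <- [seq i <- L | `[< D i >]]) half_side s i.1 ^+ k <=
      (3 * (M%:R + 1)) ^+ k.
    apply: (@packing_bound R k _ s M 1) => //.
    - by rewrite filter_uniq// undup_uniq.
    - move=> i; rewrite mem_filter => /andP[/asboolP/DV[si iM _] _]; split=> //.
      exact: half_side_le1.
    - move=> i j; rewrite !mem_filter => /andP[/asboolP Di _] /andP[/asboolP Dj _].
      exact: Ddisj.
  apply: le_trans (ler_wpM2l _ (ler_wpM2l _ pack)) _.
  - by rewrite exprn_ge0.
  - by rewrite exprn_ge0.
  have -> : (2 ^ s.+4.+1)%:R = 32 * 2 ^+ s :> R by rewrite natrX !exprS; ring.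
  have b0 : (2 ^+ s) ^+ k' != 0 :> R by rewrite !expf_neq0.
  have a0 : 2 ^+ s != 0 :> R by rewrite expf_neq0.
  rewrite !exprMn exprVn !(exprS (2 ^+ s)).
  rewrite le_eqVlt; apply/orP; left; apply/eqP.
  move: (2 ^+ s) ((2 ^+ s) ^+ k') (32 ^+ k') a0 b0 => a b e a0 b0.
  by field; rewrite a0.
Qed.

Lemma exists_scale (d : R) p : 0 < d <= 1 ->
  exists j, 2 ^+ p <= 2 ^+ j * d < 2 ^+ p.+1.
Proof.
move=> /andP[d0 d1].
have ex : exists j, 2 ^+ p <= 2 ^+ j * d.
  exists (Num.truncn (2 ^+ p / d)).+1; rewrite -ler_pdivrMr//.
  apply: le_trans (ltW (truncnS_gt _)) _.
  move: (Num.truncn _).+1 => n.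
  by rewrite -natrX ler_nat ltnW// ltn_expl.
have [j jP jmin] := ex_minnP ex; exists j; rewrite jP /=.
case: j jP jmin => [|j] jP jmin.
  by rewrite expr0 mul1r (le_lt_trans d1)// exprn_egt1// ltr1n.
rewrite exprS [X in _ < X]exprS -mulrA ltr_pM2l// ltNge; apply/negP => h.
by have := jmin _ h; rewrite ltnn.
Qed.


Lemma floor_itv_pow (c : R) p : 2 ^+ p <= `|c| < 2 ^+ p.+1 ->
  2 ^+ p <= `|(Num.floor c)%:~R : R| <= 2 ^+ p.+1.
Proof.
have powE n : 2 ^+ n = ((2 ^ n)%N%:Z)%:~R :> R by rewrite -pmulrn natrX.
have /andP[fc cf] := floor_itv c; rewrite rmorphD/= in cf.
have floor_ge (n : int) : n%:~R <= c -> n%:~R <= (Num.floor c)%:~R :> R.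
  by rewrite -floor_ge_int ler_int.
rewrite !powE; move: (2 ^ p)%N (2 ^ p.+1)%N => a b /andP[].
rewrite ler_normr ltr_norml => /orP[ac|ac] /andP[cb bc].
  have := floor_ge _ ac => h; rewrite ger0_norm; last by apply: le_trans h; rewrite ler0z.
  by rewrite h/=; lra.
have := floor_ge (- b%:Z); rewrite rmorphN/= => h.
rewrite ler_normr ler_norml; apply/andP; split; first by apply/orP; right; lra.
by rewrite h ?(ltW cb)//=; lra.
Qed.

(** Where [rho] is bounded below by a multiple of the norm, [rho]-null sets are null
   for the norm. Hence almost every point of [E] is the limit of points of [E] towards
   which [rho] is infinitesimal with respect to the norm. *)
Lemma nondegenerate_null (E : set 'rV[R]_k) : null rho k E ->
  null (fun x y => `|x - y|) k [set x | E x /\ exists n, forall y, E y ->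
    `|x - y| <= 2 ^- n -> `|x - y| <= 2 ^+ n * rho x y].
Proof.
move=> En.
pose N n w := [set x | [/\ E x, `|gridpt n.+1 w - x| <= 2 ^- n.+1 &
  forall y, E y -> `|x - y| <= 2 ^- n -> `|x - y| <= 2 ^+ n * rho x y]].
apply: (@nullS _ _ _ _ _ (\bigcup_n \bigcup_w N n w)).
  move=> x [Ex [n xn]]; have [w wx] := gridpt_near n.+1 x.
  by exists n => //; exists w.
apply: null_bigcup => // n; apply: null_bigcup_count => // w.
rewrite -[N n w]image_id; apply: (null_lipschitz (c := 2 ^+ n)) => //.
- move=> x y [Ex xw xn] [Ey yw _]; apply: xn => //.
  rewrite -[x - y](subrKA (gridpt n.+1 w)); apply: le_trans (ler_normD _ _) _.
  rewrite distrC (_ : 2 ^- n = 2 ^- n.+1 + 2 ^- n.+1); first exact: lerD.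
  rewrite exprS; have : (2:R) ^+ n != 0 by rewrite expf_neq0.
  by move: (2 ^+ n) => a a0; field.
- by apply: (nullS _ En) => x [].
Qed.

Local Notation thin_const := (K * (5 * Lam + 4) + 2 * Lam + Lam).

(** The difference of two points close for [rho] is rounded to a lattice vector [v] at
   a scale where it has length about [2^(s+4)]: rounding then perturbs the speed by a
   bounded amount, while without degeneracy it would be of order [2^s]. *)
Lemma degenerate_thin s q0 x y : x != y ->
  `|x - y| <= 2 ^- (q0 + s.+4.+2) -> 2 ^+ (q0 + s.+4.+2) * rho x y < `|x - y| ->
  (forall v q u, `|gridpt 0 v| <= 2 ^+ s.+4.+1 -> (q0 <= q)%N ->
     `|gridpt q u - x| <= 2 ^- q -> ~ bad_cube rho v s.+4.+2 (2 ^- s.+4.+2) q u) ->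
  exists j w, [/\ (s <= j)%N, `|gridpt j w - x| <= 2 ^- j & thin s j w thin_const].
Proof.
move=> xy; have [p pE] : exists p, p = s.+4 by exists s.+4.
rewrite -pE; set d := `|x - y| => xyd rxy good.
have d0 : 0 < d by rewrite normr_gt0 subr_eq0.
have d1 : d <= 1.
  by apply: le_trans xyd _; rewrite invf_le1 ?exprn_gt0// exprn_ege1// ler1n.
have [j /andP[pj jp]] : exists j, 2 ^+ p <= 2 ^+ j * d < 2 ^+ p.+1.
  by apply: exists_scale; rewrite d0 d1.
have J0 : 0 < 2 ^+ j :> R by rewrite exprn_gt0.
have jq : (q0 + p.+2 + p <= j)%N.
  rewrite -(@ler_eXn2l R 2) ?ltr1n// exprD mulrC -ler_pdivlMr ?exprn_gt0//.
  exact: le_trans pj (ler_wpM2l (ltW J0) xyd).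
pose q := (j - p.+2)%N.
have jE : j = (q + p.+2)%N.
  by rewrite /q subnK//; apply: leq_trans jq; rewrite addnAC leq_addl.
have qq : (q0 <= q)%N.
  by rewrite -(leq_add2r p.+2) -jE; apply: leq_trans jq; rewrite leq_addr.
pose v : 'rV[int]_k := \row_i Num.floor (2 ^+ j * (y - x) ord0 i).
have normj i : `|2 ^+ j * (y - x) ord0 i| <= 2 ^+ j * d.
  by rewrite normrM gtr0_norm// ler_pM2l// /d distrC ler_rV_norm.
have [i0 i0E] : exists i0, `|2 ^+ j * (y - x) ord0 i0| = 2 ^+ j * d.
  have : mx_norm (y - x) != 0 by rewrite -[mx_norm _]/(`|y - x|) distrC gt_eqF.
  move=> /mx_norm_neq0[[a i0] /= i0E]; exists i0.
  rewrite normrM gtr0_norm//; congr (_ * _); rewrite /d distrC.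
  by rewrite -[RHS]/(mx_norm (y - x)) i0E (ord1 a).
have vt : `|gridpt 0 v| <= 2 ^+ p.+1.
  apply/rV_norm_leP => [|i]; first by rewrite exprn_ge0.
  rewrite !mxE expr0 divr1; set c := _ * _.
  have cp : `|c| < 2 ^+ p.+1 by apply: le_lt_trans jp; have := normj i; rewrite !mxE.
  have /andP[fc cf] := floor_itv c.
  move: cp; rewrite ltr_norml => /andP[c1 c2].
  rewrite ler_norml (le_trans fc (ltW c2)) andbT.
  rewrite [X in - X](_ : _ = ((2 ^ p.+1)%N%:Z)%:~R); last by rewrite -pmulrn natrX.
  rewrite -rmorphN ler_int floor_ge_int rmorphN/= -pmulrn natrX.
  exact: ltW.
have v0 : 2 ^+ p <= `|(v ord0 i0)%:~R : R|.
  rewrite /v mxE; suff /andP[] : 2 ^+ p <= `|(Num.floor (2 ^+ j * (y - x) ord0 i0))%:~R : R| <= 2 ^+ p.+1 by [].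
  by apply: floor_itv_pow; rewrite i0E pj jp.
have yv : `|y - (x + gridpt j v)| <= 2 ^- j.
  apply/rV_norm_leP => [|i]; first by rewrite invr_ge0 ltW.
  have := floor_itv (2 ^+ j * (y - x) ord0 i); rewrite !mxE.
  set c := _ * (_ - _); move=> /andP[fc cf]; rewrite rmorphD/= in cf.
  rewrite -div1r ler_pdivlMr// -[X in _ * X]gtr0_norm// -normrM.
  rewrite (_ : _ * 2 ^+ j = c - (Num.floor c)%:~R); last first.
    by move: (Num.floor c)%:~R => F; rewrite /c; field; rewrite gt_eqF.
  by rewrite ler_norml; apply/andP; split; lra.
have sjx : speed rho v j x <= Lam + 2.
  rewrite /speed; apply: le_trans (ler_wpM2l (ltW J0) (lpm_tri rhoP y _ _)) _.
  rewrite mulrDr addrC lerD//.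
    apply: le_trans (ler_wpM2l (ltW J0) (lpm_lip rhoP _ _)) _.
    rewrite mulrCA -[leRHS]mulr1 ler_wpM2l//.
    by rewrite mulrC -ler_pdivlMr// div1r.
  have : 2 ^+ p * (2 ^+ j * rho x y) <= 2 ^+ p * 2.
    apply: (@le_trans _ _ (2 ^+ j * d)); last by rewrite -exprSr ltW.
    rewrite mulrCA ler_pM2l//; apply: le_trans (ltW rxy).
    rewrite ler_wpM2r ?(lpm_ge0 rhoP)// -!natrX ler_nat leq_exp2l//.
    exact: leq_trans (leqW (leqnSn p)) (leq_addl q0 p.+2).
  by rewrite ler_pM2l ?exprn_gt0.
have [u ux] := gridpt_near q x.
have [w wx] := gridpt_near j x.
have sj : (s <= j)%N.
  have sp : (s <= p)%N by rewrite pE -addn4 leq_addr.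
  exact: leq_trans sp (leq_trans (leq_addl _ _) jq).
subst p; exists j, w; split; [exact: sj|exact: wx|].
apply: (thin_cover vt v0) => z tau zw tau01.
apply: (thin_direction Lam_ge0 rhoP rhofP rhof_le vt jE sjx _ ux _ tau01).
  exact: good.
rewrite -[z - x](subrKA (gridpt j w)); apply: le_trans (ler_normD _ _) _.
apply: le_trans (lerD zw wx) _; rewrite /half_side.
have P1 : 1 <= 2 ^+ s :> R by rewrite exprn_ege1// ler1n.
rewrite -[X in _ + X <= _]div1r mulrA -mulrDl ler_pM2r ?invr_gt0// !exprS; lra.
Qed.

(** Up to a set that is null for the norm, [E] consists for every [s] of points with a
   thin cube around them, so that its [rhof]-size is at most a multiple of [2^-s]. *)
Lemma null_transfer (E : set 'rV[R]_k) : null rho k E -> null rhof k E.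
Proof.
move=> En; have supn := @null_lipschitz R 'rV[R]_k 'rV[R]_k (fun x y => `|x - y|) rhof k id.
apply: (@nullS _ _ _ _ _ (\bigcup_M (E `&` [set x | `|x| + 1 <= M.+1%:R]))).
  move=> x Ex; exists (Num.truncn (`|x| + 1)) => //; split=> //=.
  exact: ltW (truncnS_gt _).
apply: null_bigcup => // M eta eta0.
have c0 : 0 <= thin_const.
  by rewrite !addr_ge0// ?mulr_ge0// addr_ge0// mulr_ge0.
pose C : R := 32 ^+ k' * (3 * thin_const * (M.+1%:R + 1)) ^+ k.
have C0 : 0 <= C by rewrite /C mulr_ge0 ?exprn_ge0// !mulr_ge0// addr_ge0.
have [s sC] : exists s, C / 2 ^+ s <= eta / 2.
  exists (Num.truncn (2 * C / eta)).+1.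
  have : 2 * C / eta <= 2 ^+ (Num.truncn (2 * C / eta)).+1.
    apply: le_trans (ltW (truncnS_gt _)) _; move: (Num.truncn _).+1 => n.
    by rewrite -natrX ler_nat ltnW// ltn_expl.
  rewrite ler_pdivrMr// => h; rewrite ler_pdivrMr ?exprn_gt0// mulrAC.
  by move: h; move: (2 ^+ _) => a; lra.
pose Bad v := [set x | `|gridpt 0 v| <= 2 ^+ s.+4.+1 /\ (`|x| + 1 <= M.+1%:R /\
    forall q0, exists q u, [/\ (q0 <= q)%N, `|gridpt q u - x| <= 2 ^- q &
      bad_cube rho v s.+4.+2 (2 ^- s.+4.+2) q u])].
pose Z := [set x | E x /\ exists n, forall y, E y ->
    `|x - y| <= 2 ^- n -> `|x - y| <= 2 ^+ n * rho x y] `|` \bigcup_v Bad v.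
have Zn : null rhof k Z.
  rewrite -[Z]image_id; apply: (supn _ Lam) => //.
    by move=> x y _ _; exact: (lpm_lip rhofP).
  apply: nullU => //; first exact: nondegenerate_null.
  apply: null_bigcup_count => // v.
  have [vt|nvt] := pselect (`|gridpt 0 v| <= 2 ^+ s.+4.+1).
    apply: (@nullS _ _ _ _ _ _ _ (bad_null Lam_ge0 rhoP vt s.+4.+2 (tau := 2 ^- s.+4.+2) (M := M.+1) _ _ _)).
    - by move=> x [_].
    - by [].
    - by rewrite invr_gt0 exprn_gt0.
    - by [].
  apply: (@nullS _ _ _ _ _ set0); first by move=> x [].
  move=> e e0; exists (fun=> set0), (fun=> 0); split=> // S _.
  by rewrite big1 ?ltW// => i _; rewrite expr0n.
pose A := (E `&` [set x | `|x| + 1 <= M.+1%:R]) `\` Z.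
have Acov : small_cover rhof k A (C / 2 ^+ s).
  apply: thin_small_cover => //; first by move=> x [[_]].
  move=> x [[Ex xM] nZx].
  have badx v : exists q0, `|gridpt 0 v| <= 2 ^+ s.+4.+1 -> forall q u, (q0 <= q)%N ->
      `|gridpt q u - x| <= 2 ^- q -> ~ bad_cube rho v s.+4.+2 (2 ^- s.+4.+2) q u.
    apply: contrapT => /forallNP h; apply: nZx; right; exists v => //.
    have [vt|nvt] := pselect (`|gridpt 0 v| <= 2 ^+ s.+4.+1); last first.
      by have /not_implyP[] := h 0%N.
    split=> //; split=> // q0; have /not_implyP[_ /existsNP[q /existsNP[u]]] := h q0.
    by move=> /not_implyP[h1 /not_implyP[h2 /contrapT h3]]; exists q, u.
  have {badx} /choice[q0f q0fP] := badx.
  pose q0 := \max_(v <- zbox (0 : 'rV[int]_k) (2 ^ s.+4.+1)) q0f v.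
  have : ~ exists n, forall y, E y -> `|x - y| <= 2 ^- n -> `|x - y| <= 2 ^+ n * rho x y.
    by move=> h; apply: nZx; left.
  move=> /forallNP/(_ (q0 + s.+4.+2)%N)/existsNP[y /not_implyP[Ey /not_implyP[xyd]]].
  move=> /negP; rewrite -ltNge => rxy.
  apply: (@degenerate_thin s q0 x y) => //.
    apply/eqP => xy; move: rxy; rewrite xy subrr normr0 ltNge.
    by rewrite mulr_ge0 ?exprn_ge0// (lpm_ge0 rhoP).
  move=> v q u vt qq; apply: q0fP => //; apply: leq_trans qq.
  apply: leq_bigmax_seq => //; apply/(gridpt_zboxP R 0).
  by rewrite gridpt0 subr0 natrX expr0 divr1.
apply: (@small_coverS _ _ _ _ _ (\bigcup_n (if n is 0 then A else if n is 1 then Z else set0))).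
  move=> x [Ex xM]; have [Zx|nZx] := pselect (Z x); first by exists 1%N.
  by exists 0%N.
apply: (@small_cover_bigcup _ _ _ _ _ _
  (fun n : nat => if n is 0 then eta / 2 else if n is 1 then eta / 2 else 0)) => //.
- move=> [|[|n]].
  + have [U [d [AU d1 Ud sd]]] := Acov; exists U, d; split=> // S uS.
    exact: le_trans (sd _ uS) sC.
  + by apply: Zn; rewrite divr_gt0.
  + exists (fun=> set0), (fun=> 0); split=> // S _.
    by rewrite big1 // => i _; rewrite expr0n.
- move=> [|[|n]]; first by rewrite big_ord0 ltW.
    by rewrite big_ord_recl big_ord0 addr0; lra.
  rewrite !big_ord_recl big1; last by move=> i _; rewrite /bump.
  by rewrite addr0 /=; lra.
Qed.

End transfer.

Lemma null_transfer_pos (R : realType) (k : nat) (Lam K : R)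
    (rho rhof : 'rV[R]_k -> 'rV[R]_k -> R) (E : set 'rV[R]_k) :
  (0 < k)%N -> 0 <= Lam -> 0 <= K -> lip_pmetric Lam rho -> lip_pmetric Lam rhof ->
  (forall (z g : 'rV[R]_k) (S : R),
    (forall n, \sum_(s < 2 ^ n) rho (z + (s%:R / 2 ^+ n) *: g)
                                    (z + (s.+1%:R / 2 ^+ n) *: g) <= S) ->
    forall tau : R, 0 <= tau <= 1 -> rhof z (z + tau *: g) <= K * S) ->
  null rho k E -> null rhof k E.
Proof.
by case: k rho rhof E => [//|k] rho rhof E _ *; exact: (@null_transfer R k Lam K rho rhof).
Qed.

(** * Lengths of curves *)

Section budget.
Variables (R : realType) (X : metricType R).
Implicit Types (a b s t L : R) (gamma : R -> X).

(** Lengths at most [L] are witnessed by functions [l] whose increments dominate the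
   distances along the curve, the best one being the length of the initial parts.
   Such functions are easier to glue and to reparametrize than partitions. *)
Definition has_budget a b gamma L := exists l : R -> R,
  (forall s t, a <= s -> s <= t -> t <= b -> mdist (gamma s) (gamma t) <= l t - l s) /\
  l b - l a <= L.

Lemma has_budgetS a b gamma L L' : L <= L' -> has_budget a b gamma L -> has_budget a b gamma L'.
Proof. by move=> LL' [l [lP lL]]; exists l; split=> //; exact: le_trans lL LL'. Qed.

Fixpoint chain_length gamma a (s : seq R) : R :=
  if s is x :: s' then mdist (gamma a) (gamma x) + chain_length gamma x s' else 0.

Lemma partition_lengthE a b gamma (s : seq R) : partition_length a b gamma s = chain_length gamma a s.
Proof.
elim: s a => [|x s IH] a; first by rewrite /partition_length big_ord0.
rewrite /partition_length /= big_ord_recl /= -(IH x).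
by congr (_ + _); apply: eq_bigr => i _.
Qed.

Lemma budget_curve_length a b gamma L :
  has_budget a b gamma L -> (curve_length a b gamma <= L%:E)%E.
Proof.
move=> [l [lP lL]]; apply: ge_ereal_sup => _ [s sP <-]; rewrite lee_fin.
apply: le_trans lL; rewrite partition_lengthE.
have : forall a', a <= a' -> itv_partition a' b s -> chain_length gamma a' s <= l b - l a'.
  elim: s {sP} => [|x s IH] a' aa' sP /=.
    by rewrite (itv_partition_nil sP) subrr.
  have xs := itv_partition_cons sP.
  have ax : a' <= x by case: sP => /= /andP[/ltW].
  have := IH x (le_trans aa' ax) xs.
  by have := lP a' x aa' ax (itv_partition_le xs); lra.
exact.
Qed.

Lemma curve_length_ge0 a b gamma : a <= b -> (0 <= curve_length a b gamma)%E.
Proof.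
rewrite le_eqVlt => /predU1P[->|ab].
  by apply: ereal_sup_ubound; exists [::] => //; rewrite partition_lengthE.
apply: (@le_trans _ _ (partition_length a b gamma [:: b])%:E).
  by rewrite lee_fin partition_lengthE /= addr0 mdist_ge0.
by apply: ereal_sup_ubound; exists [:: b] => //; exact: itv_partition1.
Qed.

Lemma curve_length_extend a t t' gamma : a <= t -> t <= t' ->
  (curve_length a t gamma + (mdist (gamma t) (gamma t'))%:E <= curve_length a t' gamma)%E.
Proof.
move=> at_; rewrite le_eqVlt => /predU1P[->|tt']; first by rewrite mdistxx adde0.
rewrite -leeBrDr//; apply: ge_ereal_sup => _ [s sP <-].
rewrite leeBrDr// -EFinD; apply: ereal_sup_ubound; exists (s ++ [:: t']).
  exact: itv_partition_cat sP (itv_partition1 tt').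
rewrite !partition_lengthE; congr (_%:E).
elim: s a sP {at_} => [|x s IH] a sP /=.
  by rewrite (itv_partition_nil sP) addr0 add0r.
by rewrite IH ?addrA//; exact: itv_partition_cons sP.
Qed.

Lemma curve_length_budget a b gamma L : a <= b ->
  (curve_length a b gamma <= L%:E)%E -> has_budget a b gamma L.
Proof.
move=> ab lenL.
have fin t : a <= t -> t <= b -> curve_length a t gamma \is a fin_num.
  move=> at_ tb; rewrite ge0_fin_numE ?curve_length_ge0//.
  apply: le_lt_trans (ltry L); apply: le_trans lenL.
  apply: le_trans (curve_length_extend gamma at_ tb).
  by rewrite leeDl// lee_fin mdist_ge0.
exists (fun t => fine (curve_length a t gamma)); split=> [s t as_ st tb|].
  have sb := le_trans st tb; have at_ := le_trans as_ st.
  have := curve_length_extend gamma as_ st.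
  by rewrite -(fineK (fin s as_ sb)) -(fineK (fin t at_ tb)) -EFinD lee_fin; lra.
have := lenL; rewrite -(fineK (fin b ab (lexx b))) lee_fin => h.
by have := fine_ge0 (curve_length_ge0 gamma (lexx a)); lra.
Qed.

Lemma has_budget_reparam p q gamma L : p < q -> has_budget 0 1 gamma L ->
  has_budget p q (fun t => gamma ((t - p) / (q - p))) L.
Proof.
move=> pq [l [lP lL]]; have qp : 0 < q - p by lra.
exists (fun t => l ((t - p) / (q - p))); split=> [s t ps st tq|].
  apply: lP; first by apply: divr_ge0; lra.
    by rewrite ler_pM2r ?invr_gt0//; lra.
  by rewrite ler_pdivrMr//; lra.
by rewrite subrr mul0r divff// gt_eqF.
Qed.

Lemma has_budget_eq p q gamma gamma' L :
  (forall t, p <= t -> t <= q -> gamma t = gamma' t) ->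
  has_budget p q gamma L -> has_budget p q gamma' L.
Proof.
move=> gg' [l [lP lL]]; exists l; split=> // s t ps st tq.
have pt := le_trans ps st; have sq := le_trans st tq.
by rewrite -!gg'// lP.
Qed.

Lemma has_budget_dist a b gamma L : a <= b -> has_budget a b gamma L ->
  mdist (gamma a) (gamma b) <= L.
Proof. by move=> ab [l [lP]]; apply: le_trans; exact: lP. Qed.

Lemma has_budget_dist_le a b gamma L t : a <= t -> t <= b -> has_budget a b gamma L ->
  mdist (gamma a) (gamma t) <= L.
Proof.
move=> at_ tb [l [lP lL]]; have := lP a t (lexx a) at_ tb.
by have := lP t b at_ tb (lexx b); have := mdist_ge0 (gamma t) (gamma b); lra.
Qed.

End budget.

Section gaps.
Variables (R : realType) (T : set R) (s0 t0 : R).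
Hypotheses (Tclosed : closed T) (Ts0 : T s0) (Tt0 : T t0).
Implicit Types (p q s t : R).

(** The open interval from [p] to [q] is a component of the complement of [T]. *)
Definition gap p q := [/\ T p, T q, s0 <= p, p < q & q <= t0 /\
  forall t, p < t -> t < q -> ~ T t].

Lemma sup_closed (A : set R) : closed A -> has_sup A -> A (sup A).
Proof. by move=> Ac As; have := closure_sup As.1 As.2; rewrite closure_id in Ac; rewrite -Ac. Qed.

Lemma inf_closed (A : set R) : closed A -> has_inf A -> A (inf A).
Proof.
move=> Ac Ai; apply: Ac => B /nbhs_ballP[e /= e0 eB].
have [x Ax xe] := inf_adherent e0 Ai; exists x; split=> //; apply: eB.
have := ge_inf Ai.2 Ax; rewrite -ball_normE /= distrC => h.
by rewrite ger0_norm; lra.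
Qed.

Lemma gap_exists t : s0 <= t -> t <= t0 -> ~ T t -> exists p q, gap p q /\ p < t < q.
Proof.
move=> st tt nTt.
pose A := T `&` [set s | s <= t]; pose B := T `&` [set s | t <= s].
have As : has_sup A by split; [exists s0|exists t => s []].
have Bi : has_inf B by split; [exists t0|exists t => s []].
have [TA At] : A (sup A) by apply: sup_closed => //; apply: closedI => //; exact: closed_le.
have [TB Bt] : B (inf B) by apply: inf_closed => //; apply: closedI => //; exact: closed_ge.
have Alt : sup A < t by rewrite lt_neqAle At andbT; apply/eqP => E; rewrite E in TA.
have Bgt : t < inf B by rewrite lt_neqAle Bt andbT; apply/eqP => E; rewrite -E in TB.
exists (sup A), (inf B); split; last by rewrite Alt.
split=> //; first by apply: ub_le_sup; [exact: As.2|].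
  exact: lt_trans Bgt.
split; first by apply: ge_inf; [exact: Bi.2|].
move=> r Ar rB Tr; have [rt|tr] := leP r t.
  by move: Ar; rewrite ltNge => /negP; apply; apply: ub_le_sup; [exact: As.2|].
by move: rB; rewrite ltNge => /negP; apply; apply: ge_inf; [exact: Bi.2|split=> //; exact: ltW].
Qed.

Lemma gap_disjoint p q p' q' : gap p q -> gap p' q' -> p' < q -> p < q' -> p = p' /\ q = q'.
Proof.
move=> [Tp Tq _ pq [_ nT]] [Tp' Tq' _ pq' [_ nT']] p'q pq''.
have h1 : p' <= p by rewrite leNgt; apply/negP => h; exact: nT h p'q Tp'.
have h2 : p <= p' by rewrite leNgt; apply/negP => h; exact: nT' h pq'' Tp.
have h3 : q <= q' by rewrite leNgt; apply/negP => h; apply: (nT q') => //; lra.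
have h4 : q' <= q by rewrite leNgt; apply/negP => h; apply: (nT' q) => //; lra.
by split; lra.
Qed.

(** Inside a gap the budget is that of the gap; distances between points of different
   gaps are split at the ends of these gaps. *)
Lemma glue_budget (Z : metricType R) (gamma : R -> Z) (kappa : R -> R) :
  (forall s t, T s -> T t -> s0 <= s -> s <= t -> t <= t0 ->
     mdist (gamma s) (gamma t) <= kappa t - kappa s) ->
  (forall p q, gap p q -> has_budget p q gamma (kappa q - kappa p)) ->
  has_budget s0 t0 gamma (kappa t0 - kappa s0).
Proof.
move=> HT Hgap.
have /choice[pq pqP] : forall t, exists pq : R * R, s0 <= t -> t <= t0 -> ~ T t ->
    gap pq.1 pq.2 /\ pq.1 < t < pq.2.
  move=> t; have [[h1 h2 h3]|nh] := pselect [/\ s0 <= t, t <= t0 & ~ T t].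
    by have [p [q [gpq ptq]]] := gap_exists h1 h2 h3; exists (p, q).
  by exists (0, 0) => h1 h2 h3; exfalso; apply: nh.
have /choice[l lP] : forall pq : R * R, exists l : R -> R, gap pq.1 pq.2 ->
    (forall s t, pq.1 <= s -> s <= t -> t <= pq.2 ->
       mdist (gamma s) (gamma t) <= l t - l s) /\
    l pq.2 - l pq.1 <= kappa pq.2 - kappa pq.1.
  move=> [p q] /=; have [/Hgap[l lP]|ng] := pselect (gap p q); first by exists l.
  by exists id => /ng.
pose mu t := if `[< T t >] then kappa t else
  kappa (pq t).1 + (l (pq t) t - l (pq t) (pq t).1).
have muT t : T t -> mu t = kappa t by move=> Tt; rewrite /mu asboolT.
have muN t : ~ T t -> mu t = kappa (pq t).1 + (l (pq t) t - l (pq t) (pq t).1).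
  by move=> Tt; rewrite /mu asboolF.
exists mu; split; last by rewrite !muT.
have left_ t : s0 <= t -> t <= t0 -> ~ T t ->
    mdist (gamma (pq t).1) (gamma t) <= mu t - kappa (pq t).1.
  move=> st tt nTt; have [g /andP[pt tq]] := pqP t st tt nTt.
  have [h _] := lP _ g; rewrite muN//.
  by have := h (pq t).1 t (lexx _) (ltW pt) (ltW tq); lra.
have right_ t : s0 <= t -> t <= t0 -> ~ T t ->
    mdist (gamma t) (gamma (pq t).2) <= kappa (pq t).2 - mu t.
  move=> st tt nTt; have [g /andP[pt tq]] := pqP t st tt nTt.
  have [h h'] := lP _ g; rewrite muN//.
  by have := h t (pq t).2 (ltW pt) (ltW tq) (lexx _); lra.
move=> s t ss st tt; have sT := le_trans st tt; have tS := le_trans ss st.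
have tri := metric_triangle.
have [Ts|nTs] := pselect (T s); have [Tt|nTt] := pselect (T t).
- by rewrite !muT// HT.
- have [[Tp Tq sp pq1 [qt nT]] /andP[pt tq]] := pqP t tS tt nTt.
  have sp' : s <= (pq t).1.
    rewrite leNgt; apply/negP => h; apply: (nT s) => //; exact: le_lt_trans st tq.
  have := left_ t tS tt nTt; have := HT s _ Ts Tp ss sp' (ltW (lt_le_trans pq1 qt)).
  by have := tri _ _ (gamma s) (gamma (pq t).1) (gamma t); rewrite (muT s)//; lra.
- have [[Tp Tq sp pq1 [qt nT]] /andP[pt tq]] := pqP s ss sT nTs.
  have qt' : (pq s).2 <= t.
    rewrite leNgt; apply/negP => h; apply: (nT t) => //; exact: lt_le_trans pt st.
  have := right_ s ss sT nTs; have := HT _ t Tq Tt (ltW (le_lt_trans sp pq1)) qt' tt.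
  by have := tri _ _ (gamma s) (gamma (pq s).2) (gamma t); rewrite (muT t)//; lra.
have [gs /andP[ps sq]] := pqP s ss sT nTs.
have [gt /andP[pt tq]] := pqP t tS tt nTt.
have [qp|pq'] := leP (pq s).2 (pq t).1.
  have [_ Tq sp pq1 _] := gs; have [Tp _ _ pq2 [qt _]] := gt.
  have := right_ s ss sT nTs; have := left_ t tS tt nTt.
  have := HT _ _ Tq Tp (ltW (le_lt_trans sp pq1)) qp (ltW (lt_le_trans pq2 qt)).
  have := tri _ _ (gamma s) (gamma (pq s).2) (gamma t).
  by have := tri _ _ (gamma (pq s).2) (gamma (pq t).1) (gamma t); lra.
have [e1 e2] : (pq s).1 = (pq t).1 /\ (pq s).2 = (pq t).2.
  by apply: gap_disjoint => //; lra.
have e : pq s = pq t by case: (pq s) (pq t) e1 e2 => [a b] [c d] /= -> ->.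
have [h _] := lP _ gs; rewrite !muN// -e.
by rewrite -e2 in tq; have := h s t (ltW ps) st (ltW tq); lra.
Qed.

End gaps.

(** * Extended pseudometrics and lengths of segments *)

Section ext_metric.
Variables (R : realType) (k : nat) (L : R) (F : set 'rV[R]_k).
Variable g : 'rV[R]_k -> 'rV[R]_k -> R.
Hypotheses (L_ge0 : 0 <= L) (g_ge0 : forall x y, 0 <= g x y).
Hypothesis g_sym : forall x y, g x y = g y x.
Hypothesis g_tri : forall y x z, g x z <= g x y + g y z.
Hypothesis g_lip : forall x y, F x -> F y -> g x y <= L * `|x - y|.
Implicit Types (x y z e : 'rV[R]_k).

Definition path_costs x y : set R := [set r | r = L * `|x - y| \/ exists e e', [/\ F e, F e' &
  r = L * `|x - e| + g e e' + L * `|e' - y|]].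

(** For a pseudometric [g] that is [L]-Lipschitz on [F], this is its largest
   [L]-Lipschitz extension. *)
Definition ext_metric x y : R := inf (path_costs x y).

Let path_costs_ge0 x y r : path_costs x y r -> 0 <= r.
Proof. by move=> [->|[e [e' [_ _ ->]]]]; rewrite ?addr_ge0// mulr_ge0. Qed.

Let path_costs_inf x y : has_inf (path_costs x y).
Proof.
split; first by exists (L * `|x - y|); left.
by exists 0 => r; exact: path_costs_ge0.
Qed.

Lemma ext_metric_le x y r : path_costs x y r -> ext_metric x y <= r.
Proof. by move=> ?; apply: ge_inf => //; exact: (path_costs_inf x y).2. Qed.

Lemma ext_metric_ge x y c : (forall r, path_costs x y r -> c <= r) -> c <= ext_metric x y.
Proof. by move=> h; apply: lb_le_inf; [exact: (path_costs_inf x y).1|exact: h]. Qed.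

Let path_costs_sym x y r : path_costs x y r -> path_costs y x r.
Proof.
move=> [->|[e [e' [Fe Fe' ->]]]]; first by left; rewrite distrC.
right; exists e', e; split=> //.
by rewrite (distrC y) (distrC e) (g_sym e') addrC (addrC (_ * _) (g _ _)) addrA.
Qed.

Lemma ext_metricP : lip_pmetric L ext_metric.
Proof.
have norm_tri y x z : L * `|x - z| <= L * `|x - y| + L * `|y - z|.
  by rewrite -mulrDr ler_wpM2l// -[x - z](subrKA y) ler_normD.
split.
- by move=> x y; apply: ext_metric_ge => r; exact: path_costs_ge0.
- by move=> x y; apply/eqP; rewrite eq_le; apply/andP; split;
    apply: ext_metric_ge => r /path_costs_sym; exact: ext_metric_le.
- move=> y x z.
  have h r1 r2 : path_costs x y r1 -> path_costs y z r2 -> ext_metric x z <= r1 + r2.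
    move=> [->|[e [e' [Fe Fe' ->]]]] [->|[f [f' [Ff Ff' ->]]]].
    - by apply: le_trans (norm_tri y x z); apply: ext_metric_le; left.
    - apply: (@le_trans _ _ (L * `|x - f| + g f f' + L * `|f' - z|)).
        by apply: ext_metric_le; right; exists f, f'.
      by have := norm_tri y x f; lra.
    - apply: (@le_trans _ _ (L * `|x - e| + g e e' + L * `|e' - z|)).
        by apply: ext_metric_le; right; exists e, e'.
      by have := norm_tri y e' z; lra.
    - apply: (@le_trans _ _ (L * `|x - e| + g e f' + L * `|f' - z|)).
        by apply: ext_metric_le; right; exists e, f'.
      have := norm_tri y e' f; have := g_lip Fe' Ff.
      by have := g_tri e' e f'; have := g_tri f e' f'; lra.
  rewrite -lerBlDr; apply: ext_metric_ge => r1 h1.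
  by rewrite lerBlDr addrC -lerBlDr; apply: ext_metric_ge => r2 h2;
    rewrite lerBlDr addrC; exact: h.
- by move=> x y; apply: ext_metric_le; left.
Qed.

Lemma ext_metricE x y : F x -> F y -> ext_metric x y = g x y.
Proof.
have gxx x' : F x' -> g x' x' = 0.
  move=> Fx; apply/eqP; rewrite eq_le g_ge0 andbT.
  by have := g_lip Fx Fx; rewrite subrr normr0 mulr0.
move=> Fx Fy; apply/eqP; rewrite eq_le; apply/andP; split.
  apply: ext_metric_le; right; exists x, y; split=> //.
  by rewrite !subrr normr0 mulr0 add0r addr0.
apply: ext_metric_ge => r [->|[e [e' [Fe Fe' ->]]]]; first exact: g_lip.
have := g_tri e x y; have := g_tri e' e y; have := g_lip Fx Fe; have := g_lip Fe' Fy; lra.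
Qed.

(** Away from [F] the extension is a multiple of the norm, at small scales. *)
Lemma ext_metric_far x y : (forall e, F e -> `|x - y| <= `|x - e|) ->
  ext_metric x y = L * `|x - y|.
Proof.
move=> far; apply/eqP; rewrite eq_le; apply/andP; split; first by apply: ext_metric_le; left.
apply: ext_metric_ge => r [->//|[e [e' [Fe Fe' ->]]]].
have := ler_wpM2l L_ge0 (far _ Fe); have := g_ge0 e e'.
have : 0 <= L * `|e' - y| by rewrite mulr_ge0.
lra.
Qed.

End ext_metric.

Lemma ext_mdistP (R : realType) (Z : metricType R) (k : nat) (L : R)
    (F : set 'rV[R]_k) (psi : 'rV[R]_k -> Z) : 0 <= L ->
  (forall x y, F x -> F y -> mdist (psi x) (psi y) <= L * `|x - y|) ->
  lip_pmetric L (ext_metric L F (fun x y => mdist (psi x) (psi y))).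
Proof.
move=> L0 lip; apply: ext_metricP => // [x y|x y|y x z]; first exact: mdist_ge0.
  exact: metric_sym.
exact: metric_triangle.
Qed.

Lemma ext_mdistE (R : realType) (Z : metricType R) (k : nat) (L : R)
    (F : set 'rV[R]_k) (psi : 'rV[R]_k -> Z) : 0 <= L ->
  (forall x y, F x -> F y -> mdist (psi x) (psi y) <= L * `|x - y|) ->
  forall x y, F x -> F y ->
    ext_metric L F (fun x y => mdist (psi x) (psi y)) x y = mdist (psi x) (psi y).
Proof.
move=> L0 lip x y; apply: (ext_metricE L0 _ _ lip) => [x' y'|y' x' z].
  exact: mdist_ge0.
exact: metric_triangle.
Qed.

Section length_function.
Variables (R : realType) (k : nat) (L : R) (rho : 'rV[R]_k -> 'rV[R]_k -> R).
Hypothesis L_ge0 : 0 <= L.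
Hypothesis rhoP : lip_pmetric L rho.
Variables (z h : 'rV[R]_k) (S : R).
Local Notation c t := (z + t *: h).
Hypothesis S_ge : forall n, \sum_(s < 2 ^ n) rho (c (s%:R / 2 ^+ n)) (c (s.+1%:R / 2 ^+ n)) <= S.
Implicit Types (s t : R) (i n : nat).

(** A lower approximation of the length of the segment up to [t], at scale [2^-i]. *)
Definition part_length i t := \sum_(u < Num.truncn (2 ^+ i * t)) rho (c (u%:R / 2 ^+ i)) (c (u.+1%:R / 2 ^+ i)).

Let rho_c s t : rho (c s) (c t) <= L * (`|h| * `|s - t|).
Proof.
apply: le_trans (lpm_lip rhoP _ _) _; rewrite opprD addrACA subrr add0r -scalerBl.
by rewrite normrZ (mulrC `|h|).
Qed.

Let part_length_nd i t : 0 <= t -> part_length i t <= part_length i.+1 t.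
Proof.
move=> t0; pose G u := rho (c (u%:R / 2 ^+ i.+1)) (c (u.+1%:R / 2 ^+ i.+1)).
have G0 u : 0 <= G u by exact: (lpm_ge0 rhoP).
apply: (@le_trans _ _ (\sum_(u < (Num.truncn (2 ^+ i * t)).*2) G u)).
  rewrite (big_ord_doubled G); apply: ler_sum => u _.
  have E (m : nat) : m%:R / 2 ^+ i = m.*2%:R / 2 ^+ i.+1 :> R.
    rewrite -muln2 natrM exprS; have : 2 ^+ i != 0 :> R by rewrite expf_neq0.
    by move: (2 ^+ i) => a a0; field.
  by rewrite !E doubleS; exact: (lpm_tri rhoP).
rewrite /part_length -/G -(big_mkord xpredT G) -(big_mkord xpredT G).
rewrite [leRHS](@big_cat_nat _ _ _ (Num.truncn (2 ^+ i * t)).*2)//=.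
  by rewrite lerDl sumr_ge0.
have i0 : 0 <= 2 ^+ i * t by rewrite mulr_ge0 ?exprn_ge0.
rewrite truncn_ge_nat; last by rewrite mulr_ge0 ?exprn_ge0.
rewrite -muln2 natrM exprS -mulrA mulrC ler_pM2l//.
by have /andP[] := truncn_itv i0.
Qed.

Let part_length_le i n t : (i <= n)%N -> 0 <= t -> part_length i t <= part_length n t.
Proof.
move=> + t0; move: i n; apply: (nondecreasing_seqP (part_length ^~ t)).1 => i.
exact: part_length_nd.
Qed.

Let part_length_S i t : 0 <= t -> t <= 1 -> part_length i t <= S.
Proof.
move=> t0 t1; apply: le_trans (S_ge i).
rewrite /part_length -(big_mkord xpredT (fun u => rho (c (u%:R / 2 ^+ i)) (c (u.+1%:R / 2 ^+ i)))).
rewrite -(big_mkord xpredT (fun u => rho (c (u%:R / 2 ^+ i)) (c (u.+1%:R / 2 ^+ i)))).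
rewrite [leRHS](@big_cat_nat _ _ _ (Num.truncn (2 ^+ i * t)))//=.
  by rewrite lerDl sumr_ge0// => u _; exact: (lpm_ge0 rhoP).
rewrite -(ler_nat R) natrX.
have i0 : 0 <= 2 ^+ i * t by rewrite mulr_ge0 ?exprn_ge0.
have /andP[+ _] := truncn_itv i0.
by move=> /le_trans; apply; rewrite ler_piMr ?exprn_ge0.
Qed.

(** Dyadic partitions suffice to compute lengths since [rho] is continuous. *)
Definition seg_length t := sup (range (part_length ^~ t)).

Let seg_has_sup t : 0 <= t -> t <= 1 -> has_sup (range (part_length ^~ t)).
Proof.
move=> t0 t1; split; first by exists (part_length 0%N t), 0%N.
by exists S => _ [i _ <-]; exact: part_length_S.
Qed.

Lemma seg_length_ge0 t : 0 <= t -> t <= 1 -> 0 <= seg_length t.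
Proof.
move=> t0 t1; apply: (@le_trans _ _ (part_length 0%N t)).
  by apply: sumr_ge0 => u _; exact: (lpm_ge0 rhoP).
by apply: ub_le_sup; [exact: (seg_has_sup t0 t1).2|exists 0%N].
Qed.

Lemma seg_length_le t : 0 <= t -> t <= 1 -> seg_length t <= S.
Proof.
move=> t0 t1; apply: ge_sup; first exact: (seg_has_sup t0 t1).1.
by move=> _ [i _ <-]; exact: part_length_S.
Qed.

(** Both ends are moved to dyadic points, at a cost that vanishes at fine scales. *)
Lemma seg_length_dist s t : 0 <= s -> s <= t -> t <= 1 ->
  seg_length s + rho (c s) (c t) <= seg_length t.
Proof.
move=> s0 st t1; have t0 := le_trans s0 st; have s1 := le_trans st t1.
rewrite -lerBrDr; apply: ge_sup; first exact: (seg_has_sup s0 s1).1.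
move=> _ [i0 _ <-]; rewrite lerBrDr; apply/ler_addgt0Pr => e e0.
pose B := 2 * (L * `|h|); have B0 : 0 <= B by rewrite !mulr_ge0.
have [i [i0i Be]] : exists i, (i0 <= i)%N /\ B / 2 ^+ i <= e.
  exists (maxn i0 (Num.truncn (B / e)).+1); split; first exact: leq_maxl.
  rewrite ler_pdivrMr ?exprn_gt0// mulrC -ler_pdivrMr//.
  apply: le_trans (ltW (truncnS_gt _)) _; move: (Num.truncn _).+1 => n.
  rewrite -natrX ler_nat; apply: leq_trans (ltnW (ltn_expl _ (ltnSn 1))) _.
  by rewrite leq_exp2l// leq_maxr.
apply: le_trans (lerD (part_length_le i0i s0) (lexx _)) _.
have J0 : 0 < 2 ^+ i :> R by rewrite exprn_gt0.
have trunc_near (r : R) : 0 <= r -> `|r - (Num.truncn (2 ^+ i * r))%:R / 2 ^+ i| <= 2 ^- i.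
  move=> r0; have /andP[h1 h2] := truncn_itv (mulr_ge0 (ltW J0) r0).
  rewrite -[(Num.truncn _).+1%:R]natr1 in h2.
  move: (Num.truncn _)%:R h1 h2 => a h1 h2.
  rewrite (_ : r - a / 2 ^+ i = (2 ^+ i * r - a) / 2 ^+ i); last by field; rewrite gt_eqF.
  rewrite normrM normfV (gtr0_norm J0) ler_pdivrMr// mulVf ?gt_eqF//.
  by rewrite ler_norml; apply/andP; split; lra.
pose m (r : R) := Num.truncn (2 ^+ i * r).
have ms : (m s <= m t)%N by apply: le_truncn; rewrite ler_pM2l.
have chain n : (m s <= n)%N ->
    part_length i s + rho (c ((m s)%:R / 2 ^+ i)) (c (n%:R / 2 ^+ i)) <=
    \sum_(u < n) rho (c (u%:R / 2 ^+ i)) (c (u.+1%:R / 2 ^+ i)).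
  elim: n => [|n IH].
    rewrite leqn0 => /eqP ms0; rewrite /part_length -/(m s) ms0 !big_ord0 add0r.
    by have := rho_c (0%:R / 2 ^+ i) (0%:R / 2 ^+ i); rewrite subrr normr0 !mulr0.
  rewrite leq_eqVlt => /predU1P[<-|].
    rewrite /part_length -/(m s); rewrite gerDl.
    by have := rho_c ((m s)%:R / 2 ^+ i) ((m s)%:R / 2 ^+ i); rewrite subrr normr0 !mulr0.
  rewrite ltnS => /IH{}IH; rewrite big_ord_recr /=; apply: le_trans (lerD IH (lexx _)).
  by rewrite -addrA lerD2l (lpm_tri rhoP).
have h1 := chain _ ms.
have h2 : part_length i t <= seg_length t.
  by apply: ub_le_sup; [exact: (seg_has_sup t0 t1).2|exists i].
have h3 := lpm_tri rhoP (c ((m s)%:R / 2 ^+ i)) (c s) (c t).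
have h4 := lpm_tri rhoP (c ((m t)%:R / 2 ^+ i)) (c ((m s)%:R / 2 ^+ i)) (c t).
have near_rho a b : `|a - b| <= 2 ^- i -> rho (c a) (c b) <= B / 2 ^+ i / 2.
  move=> ab; apply: le_trans (rho_c a b) _.
  rewrite (_ : B / 2 ^+ i / 2 = L * `|h| * 2 ^- i); last by rewrite /B; field; rewrite gt_eqF.
  by rewrite mulrA ler_wpM2l// mulr_ge0.
have h5 := near_rho _ _ (trunc_near s s0).
have h6 := near_rho _ _ (trunc_near t t0).
rewrite (lpm_sym rhoP (c t)) -/(m t) in h6; rewrite -/(m s) in h5.
move: h1; rewrite -/(part_length i t); lra.
Qed.

End length_function.

(** * Filling the gaps of a closed set *)

(** A lower bound on the growth that holds near each interior point holds globally: the
   points up to which it holds have a supremum, which cannot be interior. *)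
Lemma local_growth (R : realType) (nu : R -> R) (B s t : R) : s <= t -> 0 <= B ->
  (forall u1 u2, s <= u1 -> u1 <= u2 -> u2 <= t -> nu u1 <= nu u2) ->
  (forall u, s < u -> u < t -> exists2 d : R, 0 < d & forall u1 u2, s <= u1 -> u1 <= u2 ->
     u2 <= t -> `|u1 - u| < d -> `|u2 - u| < d -> B * (u2 - u1) <= nu u2 - nu u1) ->
  B * (t - s) <= nu t - nu s.
Proof.
move=> st B0 nd loc.
have inner s' t' : s < s' -> s' <= t' -> t' < t -> B * (t' - s') <= nu t' - nu s'.
  move=> ss' s't' tt'.
  pose A := [set u | [/\ s' <= u, u <= t' & B * (u - s') <= nu u - nu s']].
  have As' : A s' by split=> //; rewrite !subrr mulr0.
  have supA : has_sup A by split; [exists s'|exists t' => u []].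
  have a1 : s' <= sup A by apply: ub_le_sup => //; exact: supA.2.
  have a2 : sup A <= t' by apply: ge_sup; [exact: supA.1|move=> u []].
  have [d d0 dP] := loc (sup A) (lt_le_trans ss' a1) (le_lt_trans a2 tt').
  have [u [u1 u2 uB] ua] := sup_adherent d0 supA.
  have ua' : u <= sup A by apply: ub_le_sup; [exact: supA.2|].
  have key w : sup A <= w -> w <= t' -> w < sup A + d -> A w.
    move=> aw wt wd; split; [exact: le_trans a1 aw|exact: wt|].
    have uw := le_trans ua' aw.
    have := dP u w (le_trans (ltW ss') u1) uw (le_trans wt (ltW tt')).
    have -> : `|u - sup A| < d by rewrite distrC ger0_norm; lra.
    have -> : `|w - sup A| < d by rewrite ger0_norm; lra.
    by move=> /(_ isT isT); lra.
  have [lt_at|le_ta] := ltP (sup A) t'; last first.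
    by have [] // : A t' by apply: key => //; lra.
  have Aw : A (Num.min t' (sup A + d / 2)).
    by apply: key; rewrite ?le_min ?ge_min ?lexx ?(ltW lt_at) ?gt_min/=; lra.
  have : Num.min t' (sup A + d / 2) <= sup A by apply: ub_le_sup; [exact: supA.2|].
  by rewrite ge_min => /orP[]; lra.
rewrite leNgt; apply/negP => lt_B.
have D0 := nd s t (lexx _) st (lexx _).
have B1 : 0 < B * (t - s) by lra.
have ts : 0 < t - s.
  by rewrite lt_neqAle subr_ge0 st andbT; apply/eqP => E; move: B1; rewrite -E mulr0 ltxx.
(* A small proportion of the interval is cut off at both ends, so that the bound on the
   rest still contradicts the defect. *)
have theta (x y : R) : 0 < x -> 0 <= y -> y < x ->
    exists th, [/\ 0 < th, th <= 1 / 4 & th * x = (x - y) / 4].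
  move=> x0 y0 yx; exists ((x - y) / (4 * x)).
  have x4 : 0 < 4 * x by rewrite mulr_gt0.
  split; [by rewrite divr_gt0// subr_gt0|by rewrite ler_pdivrMr//; lra|].
  by field; rewrite gt_eqF.
have D1 : 0 <= nu t - nu s by lra.
have [th [th0 th1 thB]] := theta _ _ B1 D1 lt_B.
have thts : 0 < th * (t - s) by rewrite mulr_gt0.
have thts1 : th * (t - s) <= 1 / 4 * (t - s) by rewrite ler_wpM2r// ltW.
have h1 : s < s + th * (t - s) by lra.
have h2 : s + th * (t - s) <= t - th * (t - s) by lra.
have h3 : t - th * (t - s) < t by lra.
have := inner _ _ h1 h2 h3.
have -> : B * (t - th * (t - s) - (s + th * (t - s))) =
    B * (t - s) - 2 * (th * (B * (t - s))) by ring.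
have := nd s _ (lexx _) (ltW h1) (le_trans h2 (ltW h3)).
have := nd _ t (le_trans (ltW h1) h2) (ltW h3) (lexx _).
rewrite thB; lra.
Qed.

Section within_itv.
Variables (R : realType) (X : metricType R) (a b : R) (gamma : R -> X).
Import metricType_numDomainType.

Lemma within_itvP : {within `[a, b], continuous gamma} <->
  forall t, a <= t <= b -> forall e : R, 0 < e -> exists2 d : R, 0 < d &
    forall s, a <= s <= b -> `|s - t| < d -> mdist (gamma t) (gamma s) < e.
Proof.
rewrite subspace_continuousP; split=> [h t tab e e0|h t tab].
  have tab' : `[a, b]%classic t by rewrite /= in_itv.
  have /cvgrPdist_lt/(_ e e0) := h t tab'.
  move=> /nbhs_ballP[d /= d0 dP]; exists d => // s sab st.
  by apply: dP; [rewrite -ball_normE /= distrC|rewrite /= in_itv].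
apply/cvgrPdist_lt => e e0.
have tab' : a <= t <= b by move: tab; rewrite /= in_itv.
have [d d0 dP] := h t tab' e e0.
apply/nbhs_ballP; exists d => // s; rewrite -ball_normE /= distrC => st sab.
by apply: dP => //; move: sab; rewrite in_itv.
Qed.

End within_itv.

Section fill.
Variables (R : realType) (X : metricType R) (C Lam : R).
Hypotheses (C_ge0 : 0 <= C) (Lam_ge0 : 0 <= Lam).
Hypothesis qc : forall x y : X, exists gamma : R -> X,
    [/\ rectifiable 0 1 gamma, gamma 0 = x, gamma 1 = y &
        (curve_length 0 1 gamma <= (C * mdist x y)%:E)%E].
Variables (T : set R) (s0 t0 : R) (psi : R -> X).
Hypotheses (Tclosed : closed T) (Ts0 : T s0) (Tt0 : T t0).
Hypothesis psi_lip : forall s t, T s -> T t -> mdist (psi s) (psi t) <= Lam * `|s - t|.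

(** The curve that fills a gap stays within a constant times the length of the gap from
   its ends, which gives continuity where gaps accumulate. *)
Lemma fill_gaps : exists gamma : R -> X,
  [/\ forall t, T t -> gamma t = psi t,
      {within `[s0, t0], continuous gamma} &
      forall p q, gap T s0 t0 p q -> exists eta : R -> X,
        [/\ rectifiable 0 1 eta, (curve_length 0 1 eta <= (C * (Lam * (q - p)))%:E)%E &
            forall t, p <= t -> t <= q -> gamma t = eta ((t - p) / (q - p))]].
Proof.
have /choice[pq pqP] : forall t, exists pq : R * R, s0 <= t -> t <= t0 -> ~ T t ->
    gap T s0 t0 pq.1 pq.2 /\ pq.1 < t < pq.2.
  move=> t; have [[h1 h2 h3]|nh] := pselect [/\ s0 <= t, t <= t0 & ~ T t].
    by have [p [q [gpq ptq]]] := gap_exists Tclosed Ts0 Tt0 h1 h2 h3; exists (p, q).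
  by exists (0, 0) => h1 h2 h3; exfalso; apply: nh.
have /choice[eta etaP] : forall pq : R * R, exists eta : R -> X,
    [/\ rectifiable 0 1 eta, eta 0 = psi pq.1, eta 1 = psi pq.2 &
     (curve_length 0 1 eta <= (C * mdist (psi pq.1) (psi pq.2))%:E)%E].
  by move=> pq'; exact: qc.
pose gamma t := if `[< T t >] then psi t else
  eta (pq t) ((t - (pq t).1) / ((pq t).2 - (pq t).1)).
have gammaT t : T t -> gamma t = psi t by move=> Tt; rewrite /gamma asboolT.
have gammaN p q t : gap T s0 t0 p q -> p <= t -> t <= q ->
    gamma t = eta (p, q) ((t - p) / (q - p)).
  move=> g pt tq; have [Tp Tq sp pq0 [qt nT]] := g.
  have [_ e0 e1 _] := etaP (p, q).
  move: pt; rewrite le_eqVlt => /predU1P[<-|pt].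
    by rewrite gammaT// subrr mul0r e0.
  move: tq; rewrite le_eqVlt => /predU1P[->|tq].
    by rewrite gammaT// divff ?e1// subr_eq0 gt_eqF.
  have nTt := nT t pt tq.
  have [g' /andP[pt' tq']] := pqP t (le_trans sp (ltW pt)) (le_trans (ltW tq) qt) nTt.
  have [e1' e2'] : (pq t).1 = p /\ (pq t).2 = q.
    by apply: gap_disjoint g' g _ _; lra.
  rewrite /gamma asboolF//.
  by case: (pq t) e1' e2' => [p' q'] /= -> ->.
have eta_len p q : gap T s0 t0 p q ->
    (curve_length 0 1 (eta (p, q)) <= (C * (Lam * (q - p)))%:E)%E.
  move=> [Tp Tq _ pq0 _]; have [_ _ _ /= lenq] := etaP (p, q).
  apply: le_trans lenq _; rewrite lee_fin ler_wpM2l//.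
  by apply: le_trans (psi_lip Tp Tq) _; rewrite distrC gtr0_norm// subr_gt0.
exists gamma; split=> // [|p q g]; last first.
  exists (eta (p, q)); split; [by have [] := etaP (p, q)|exact: eta_len|].
  by move=> t; exact: gammaN.
have gap_cont p q t (e : R) : gap T s0 t0 p q -> p <= t -> t <= q -> 0 < e ->
    exists2 d : R, 0 < d & forall s, p <= s -> s <= q -> `|s - t| < d ->
      mdist (gamma t) (gamma s) < e.
  move=> g pt tq e0; have [_ _ _ pq0 _] := g; have qp : 0 < q - p by rewrite subr_gt0.
  have [[[_ cont] _] _ _ _] := etaP (p, q).
  have t01 u : p <= u -> u <= q -> 0 <= (u - p) / (q - p) <= 1.
    move=> pu uq; apply/andP; split; first by apply: divr_ge0; lra.
    by rewrite ler_pdivrMr//; lra.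
  have [d d0 dP] := (within_itvP _ _ _).1 cont _ (t01 t pt tq) e e0.
  exists (d * (q - p)); first by rewrite mulr_gt0.
  move=> s ps sq st; rewrite !(gammaN p q)//; apply: dP; first exact: t01.
  rewrite -mulrBl normrM normfV (gtr0_norm qp) ltr_pdivrMr//.
  by rewrite (_ : s - p - (t - p) = s - t)//; ring.
apply/within_itvP => t /andP[st tt] e e0.
have [Tt|nTt] := pselect (T t); last first.
  have [g /andP[pt tq]] := pqP t st tt nTt.
  have [d d0 dP] := gap_cont _ _ t e g (ltW pt) (ltW tq) e0.
  exists (Num.min d (Num.min (t - (pq t).1) ((pq t).2 - t))).
    by rewrite !lt_min d0 !subr_gt0 pt tq.
  move=> s _; rewrite !lt_min => /and3P[sd]; rewrite !ltr_norml.
  by move=> /andP[s1 _] /andP[_ s2]; apply: dP => //; lra.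
(* Points enclosed between [t] and a nearby point of [T] have nearby images, whichever
   gap they lie in; if [T] has no point near [t] on one side, a gap begins at [t]. *)
have L0 := Lam_ge0; pose CC := Lam + C * Lam + 1.
have CC0 : 0 < CC by rewrite /CC; have := mulr_ge0 C_ge0 Lam_ge0; lra.
have between e' s : T e' -> s0 <= e' -> e' <= t0 ->
    (t <= s /\ s <= e') \/ (e' <= s /\ s <= t) -> CC * `|e' - t| < e ->
    mdist (gamma t) (gamma s) < e.
  move=> Te' se' te' bet; apply: le_lt_trans.
  have [Ts|nTs] := pselect (T s).
    rewrite !gammaT//; apply: le_trans (psi_lip Tt Ts) _.
    apply: (@le_trans _ _ (Lam * `|e' - t|)).
      by rewrite ler_wpM2l//; case: bet => -[h1 h2];
        [rewrite distrC !ger0_norm; lra|rewrite ger0_norm ?ler0_norm; lra].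
    by rewrite ler_wpM2r// /CC; have := mulr_ge0 C_ge0 Lam_ge0; lra.
  have ss : s0 <= s by case: bet; lra.
  have sT : s <= t0 by case: bet; lra.
  have [g /andP[ps sq]] := pqP s ss sT nTs.
  move: (pq s).1 (pq s).2 g ps sq => p q g ps sq.
  have [Tp Tq sp pq0 [qt nT]] := g.
  have side u : T u -> u <= p \/ q <= u.
    by move=> Tu; have [|pu] := leP u p; [left|right; rewrite leNgt; apply/negP => uq; exact: nT pu uq Tu].
  have [tp et] : `|t - p| <= `|e' - t| /\ q - p <= `|e' - t|.
    have := side _ Tt; have := side _ Te'.
    by case: bet => -[h1 h2]; [rewrite [`|e' - t|]ger0_norm; last lra|
      rewrite [`|e' - t|]ler0_norm; last lra]; rewrite ler_norml; move=> [] ? [] ?;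
      split; lra.
  have : mdist (gamma p) (gamma s) <= C * (Lam * (q - p)).
    apply: (@has_budget_dist_le R X p q) (ltW ps) (ltW sq) _.
    apply: has_budget_eq (has_budget_reparam pq0 (curve_length_budget ler01 (eta_len _ _ g))).
    by move=> u pu uq; rewrite (gammaN p q).
  have : mdist (gamma t) (gamma p) <= Lam * `|t - p| by rewrite !gammaT// psi_lip.
  have := metric_triangle (gamma t) (gamma p) (gamma s).
  have := ler_wpM2l Lam_ge0 tp; have := ler_wpM2l C_ge0 (ler_wpM2l Lam_ge0 et).
  have := normr_ge0 (e' - t).
  rewrite /CC mulrDl mulrDl mul1r -(mulrA C); lra.
pose d0 := e / (2 * CC).
have d00 : 0 < d0 by rewrite divr_gt0// mulr_gt0.
have close e' : `|e' - t| < d0 -> CC * `|e' - t| < e.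
  move=> h; have : CC * `|e' - t| < CC * d0 by rewrite ltr_pM2l.
  have -> : CC * d0 = e / 2 by rewrite /d0; field; rewrite gt_eqF.
  lra.
have right_ : exists2 d : R, 0 < d & forall s, s <= t0 -> t <= s -> s - t < d ->
    mdist (gamma t) (gamma s) < e.
  have [[e' [Te' te' et0 ed]]|nex] := pselect (exists e', [/\ T e', t < e', e' <= t0 & e' - t < d0]).
    exists (e' - t); first lra.
    move=> s sT ts sd; apply: (between e') => //; [lra|left; split; lra|].
    by apply: close; rewrite gtr0_norm; lra.
  have := tt; rewrite le_eqVlt => /predU1P[tE|ltt].
    exists 1 => // s sT ts _; have -> : s = t by lra.
    by rewrite mdistxx.
  pose u := t + Num.min (t0 - t) d0 / 2.
  have m0 : 0 < Num.min (t0 - t) d0 by rewrite lt_min d00 subr_gt0 ltt.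
  have [m1 m2] : Num.min (t0 - t) d0 <= t0 - t /\ Num.min (t0 - t) d0 <= d0.
    by rewrite !ge_min !lexx orbT.
  have nTu w : t < w -> w <= u -> ~ T w.
    by move=> tw wu Tw; apply: nex; exists w; split=> //; rewrite /u in wu; lra.
  have tu : t < u by rewrite /u; lra.
  have ut0 : u <= t0 by rewrite /u; lra.
  have [g /andP[pu uq]] := pqP u (le_trans st (ltW tu)) ut0 (nTu u tu (lexx _)).
  move: (pq u).1 (pq u).2 g pu uq => p q g pu uq; have [Tp Tq sp pq0 [qt nT]] := g.
  have pt : p <= t by rewrite leNgt; apply/negP => h; exact: nTu h (ltW pu) Tp.
  have [d dd dP] := gap_cont p q t e g pt (ltW (lt_trans tu uq)) e0.
  exists (Num.min d (q - t)); first by rewrite lt_min dd subr_gt0 (lt_trans tu).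
  move=> s sT ts; rewrite lt_min => /andP[sd sq].
  by apply: dP; [lra|lra|rewrite ger0_norm; lra].
have left_ : exists2 d : R, 0 < d & forall s, s0 <= s -> s <= t -> t - s < d ->
    mdist (gamma t) (gamma s) < e.
  have [[e' [Te' te' et0 ed]]|nex] := pselect (exists e', [/\ T e', e' < t, s0 <= e' & t - e' < d0]).
    exists (t - e'); first lra.
    move=> s sS ts sd; apply: (between e') => //; [lra|right; split; lra|].
    by apply: close; rewrite distrC gtr0_norm; lra.
  have := st; rewrite le_eqVlt => /predU1P[tE|ltt].
    exists 1 => // s sS ts _; have -> : s = t by lra.
    by rewrite mdistxx.
  pose u := t - Num.min (t - s0) d0 / 2.
  have m0 : 0 < Num.min (t - s0) d0 by rewrite lt_min d00 subr_gt0 ltt.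
  have [m1 m2] : Num.min (t - s0) d0 <= t - s0 /\ Num.min (t - s0) d0 <= d0.
    by rewrite !ge_min !lexx orbT.
  have nTu w : w < t -> u <= w -> ~ T w.
    by move=> tw wu Tw; apply: nex; exists w; split=> //; rewrite /u in wu; lra.
  have tu : u < t by rewrite /u; lra.
  have us0 : s0 <= u by rewrite /u; lra.
  have [g /andP[pu uq]] := pqP u us0 (le_trans (ltW tu) tt) (nTu u tu (lexx _)).
  move: (pq u).1 (pq u).2 g pu uq => p q g pu uq; have [Tp Tq sp pq0 [qt nT]] := g.
  have tq : t <= q by rewrite leNgt; apply/negP => h; exact: nTu h (ltW uq) Tq.
  have [d dd dP] := gap_cont p q t e g (ltW (lt_trans pu tu)) tq e0.
  exists (Num.min d (t - p)); first by rewrite lt_min dd subr_gt0 (lt_trans pu).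
  move=> s sS ts; rewrite lt_min => /andP[sd sq].
  by apply: dP; [lra|lra|rewrite ler0_norm; lra].
have [d1 d10 d1P] := right_; have [d2 d20 d2P] := left_.
exists (Num.min d1 d2); first by rewrite lt_min d10.
move=> s /andP[sS sT]; rewrite lt_min => /andP[sd1 sd2].
have [ts|ts] := leP t s; first by apply: d1P => //; rewrite ger0_norm in sd1; lra.
by apply: d2P => //; first lra; rewrite ltr0_norm in sd2; lra.
Qed.

End fill.

(** * Weak BLD maps *)

Section curve_bound.
Variables (R : realType) (X Y : metricType R) (Phi : X -> Y) (M C : R).
Hypotheses (M_ge1 : 1 <= M) (C_ge1 : 1 <= C).
Hypothesis bld : forall (a b : R) (gamma : R -> X), rectifiable a b gamma ->
  (M^-1%:E * curve_length a b gamma <= curve_length a b (Phi \o gamma))%E /\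
  (curve_length a b (Phi \o gamma) <= M%:E * curve_length a b gamma)%E.
Hypothesis qc : forall x y : X, exists gamma : R -> X,
  [/\ rectifiable 0 1 gamma, gamma 0 = x, gamma 1 = y &
      (curve_length 0 1 gamma <= (C * mdist x y)%:E)%E].

Let bld_le a b gamma B : rectifiable a b gamma ->
  (curve_length a b gamma <= B%:E)%E -> (curve_length a b (Phi \o gamma) <= (M * B)%:E)%E.
Proof.
move=> rg lenB; apply: le_trans (bld rg).2 _; rewrite EFinM.
by rewrite lee_pmul2l// lte_fin; apply: lt_le_trans M_ge1.
Qed.

Let bld_ge a b gamma B : rectifiable a b gamma ->
  (curve_length a b (Phi \o gamma) <= B%:E)%E -> (curve_length a b gamma <= (M * B)%:E)%E.
Proof.
move=> rg lenB; have M0 : 0 < M by apply: lt_le_trans M_ge1.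
by rewrite EFinM -lee_pdivrMl//; exact: le_trans (bld rg).1 lenB.
Qed.

Lemma BLD_lipschitz x y : mdist (Phi x) (Phi y) <= M * C * mdist x y.
Proof.
have [gamma [rg <- <- len]] := qc x y.
have := curve_length_budget ler01 (bld_le rg len).
by rewrite mulrA; move=> /(has_budget_dist ler01).
Qed.

Variables (k : nat) (L : R) (F : set 'rV[R]_k) (phi : 'rV[R]_k -> X).
Hypotheses (L_ge0 : 0 <= L) (Fclosed : closed F).
Hypothesis phi_lip : forall x y, F x -> F y -> mdist (phi x) (phi y) <= L * `|x - y|.
Hypothesis Phi_phi_lip : forall x y, F x -> F y ->
  mdist (Phi (phi x)) (Phi (phi y)) <= L * `|x - y|.

Local Notation rhof := (ext_metric L F (fun x y => mdist (phi x) (phi y))).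
Local Notation rho := (ext_metric L F (fun x y => mdist (Phi (phi x)) (Phi (phi y)))).

Let rhofP : lip_pmetric L rhof.
Proof. exact: ext_mdistP. Qed.

Let rhoP : lip_pmetric L rho.
Proof. exact: (ext_mdistP (psi := fun x => Phi (phi x))). Qed.

Section segment.
Variables (z h : 'rV[R]_k) (S : R).
Hypothesis S_ge : forall n, \sum_(s < 2 ^ n) rho (z + (s%:R / 2 ^+ n) *: h)
  (z + (s.+1%:R / 2 ^+ n) *: h) <= S.
Local Notation c t := (z + t *: h).
Local Notation nu := (seg_length rho z h).

Let c_dist (s t : R) : `|c s - c t| = `|h| * `|s - t|.
Proof.
by rewrite opprD addrACA subrr add0r -scalerBl normrZ mulrC.
Qed.

(** Off [F] the pseudometric is locally a multiple of the norm, hence so is length. *)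
Lemma seg_length_gap (s t : R) : 0 <= s -> s <= t -> t <= 1 ->
  (forall u, s < u -> u < t -> ~ F (c u)) ->
  L * `|h| * (t - s) <= nu t - nu s.
Proof.
move=> s0 st t1 nF.
have grow u1 u2 : s <= u1 -> u1 <= u2 -> u2 <= t -> rho (c u1) (c u2) <= nu u2 - nu u1.
  move=> su uu ut; rewrite lerBrDl.
  by apply: (seg_length_dist L_ge0 rhoP S_ge); lra.
apply: local_growth => //; first by rewrite mulr_ge0.
  move=> u1 u2 su uu ut; rewrite -subr_ge0; apply: le_trans (grow _ _ su uu ut).
  exact: (lpm_ge0 rhoP).
move=> u su ut.
have [d0 d00 far] : exists2 d : R, 0 < d & forall e, F e -> d <= `|c u - e|.
  have /nbhs_ballP[d /= dd dF] : nbhs (c u) (~` F).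
    by apply: open_nbhs_nbhs; split; [exact: closed_openC|exact: nF].
  exists d => // e Fe; rewrite leNgt; apply/negP => h'.
  by apply: (dF e) => //; rewrite -ball_normE.
have h1 : 0 < 3 * (`|h| + 1) by rewrite mulr_gt0// ltr_wpDl.
exists (d0 / (3 * (`|h| + 1))); first by rewrite divr_gt0.
move=> u1 u2 su1 u12 u2t; rewrite !ltr_pdivlMr// => d1 d2.
apply: le_trans (grow _ _ su1 u12 u2t).
have hd (w : R) : `|w| * (3 * (`|h| + 1)) < d0 -> 3 * (`|h| * `|w|) <= d0.
  by have := normr_ge0 w; rewrite !mulrDr mulr1; move: (mulrC `|w| `|h|); lra.
have hd1 := hd _ d1; have hd2 := hd _ d2.
have d12 : `|c u1 - c u2| <= 2 / 3 * d0.
  rewrite c_dist; have : `|h| * `|u1 - u2| <= `|h| * (`|u1 - u| + `|u2 - u|).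
    by rewrite ler_wpM2l// (distrC u2) -[u1 - u2](subrKA u) ler_normD.
  by rewrite mulrDr; lra.
rewrite ext_metric_far //.
- by rewrite c_dist mulrA distrC ger0_norm// subr_ge0.
- by move=> *; exact: mdist_ge0.
move=> e Fe; apply: le_trans d12 _.
have := ler_normD (c u - c u1) (c u1 - e); rewrite subrKA.
by have := far _ Fe; rewrite c_dist (distrC u); lra.
Qed.

(** Fill the gaps of the segment in [F] to get a curve in [X]; its image in [Y] has
   length at most a multiple of the [rho]-length of the segment, the gaps being
   charged to the pieces on which [rho] is a multiple of the norm. *)
Lemma segment_bound (tau : R) : 0 <= tau <= 1 -> rhof z (c tau) <= M * (M * C) * S.
Proof.
move=> /andP[tau0 tau1].
have M1 := M_ge1; have C1 := C_ge1.
have M0 : 0 <= M by lra.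
have C0 : 0 <= C by lra.
have MC1 : 1 <= M * C by rewrite -[1]mulr1; apply: ler_pM.
have K1 : 1 <= M * (M * C) by rewrite -[1]mulr1; apply: ler_pM.
have Lh0 : 0 <= L * `|h| by rewrite mulr_ge0.
have K0 : 0 <= M * (M * C) by lra.
suff bound : rhof z (c tau) <= M * (M * C) * (nu tau - nu 0).
  apply: le_trans bound _; rewrite ler_wpM2l//.
  have := seg_length_le rhoP S_ge tau0 tau1.
  by have := seg_length_ge0 rhoP S_ge (lexx 0) ler01; lra.
have rhof_seg (s t : R) : s <= t -> rhof (c s) (c t) <= L * `|h| * (t - s).
  move=> st; apply: le_trans (lpm_lip rhofP _ _) _.
  by rewrite c_dist mulrA distrC ger0_norm// subr_ge0.
have rhof_gap (s t : R) : 0 <= s -> s <= t -> t <= tau ->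
    (forall u, s < u -> u < t -> ~ F (c u)) ->
    rhof (c s) (c t) <= M * (M * C) * (nu t - nu s).
  move=> s0 st ttau nF; apply: le_trans (rhof_seg s t st) _.
  have g := seg_length_gap s0 st (le_trans ttau tau1) nF.
  apply: le_trans g _; rewrite ler_peMl//.
  apply: le_trans (seg_length_gap s0 st (le_trans ttau tau1) nF).
  by rewrite mulr_ge0// subr_ge0.
have c0 : c 0 = z by rewrite scale0r addr0.
pose T := [set t : R | 0 <= t <= tau] `&` [set t | F (c t)].
have Tclosed : closed T.
  apply: closedI.
    rewrite (_ : [set t : R | 0 <= t <= tau] = `[0, tau]%classic).
      exact: itv_closed.
    by apply/seteqP; split=> t /=; rewrite in_itv.
  apply: (@closed_comp _ _ (fun t : R => c t) F) => // t _.
  apply: (@continuousD _ _ _ (cst z) (fun t : R => t *: h)); first exact: cst_continuous.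
  exact: scalel_continuous.
have [Tne|Te] := pselect (T !=set0); last first.
  rewrite -{1}c0; apply: rhof_gap => // u u0 utau Fu.
  by apply: Te; exists u; split=> //=; lra.
have supT : has_sup T by split=> //; exists tau => t [/andP[]].
have infT : has_inf T by split=> //; exists 0 => t [/andP[]].
set s0 := inf T; set t0 := sup T.
have Ts0 : T s0 by exact: inf_closed.
have Tt0 : T t0 by exact: sup_closed.
have [/andP[s00 s0tau] Fs0] := Ts0; have [/andP[t00 t0tau] Ft0] := Tt0.
have s0t0 : s0 <= t0 by apply: ub_le_sup => //; exact: supT.2.
have out u : 0 <= u -> u <= tau -> u < s0 \/ t0 < u -> ~ F (c u).
  move=> u0 utau ust Fu; have Tu : T u by split=> //=; lra.
  case: ust => [us|tu].
    by move: us; rewrite ltNge => /negP; apply; apply: ge_inf => //; exact: infT.2.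
  by move: tu; rewrite ltNge => /negP; apply; apply: ub_le_sup => //; exact: supT.2.
pose psi (t : R) := phi (c t).
have psi_lip (s t : R) : T s -> T t -> mdist (psi s) (psi t) <= L * `|h| * `|s - t|.
  by move=> [_ Fs] [_ Ft]; apply: le_trans (phi_lip Fs Ft) _; rewrite c_dist mulrA.
have [gamma [gammaT gamma_cont gamma_gap]] :=
  fill_gaps C0 Lh0 qc Tclosed Ts0 Tt0 psi_lip.
have rect : rectifiable s0 t0 gamma.
  split; first by split.
  apply: le_lt_trans (ltry (C * (L * `|h|) * t0 - C * (L * `|h|) * s0)).
  apply: budget_curve_length.
  apply: (glue_budget Tclosed Ts0 Tt0 (kappa := fun t => C * (L * `|h|) * t)).
    move=> s t Ts Tt _ st _; rewrite !gammaT//; apply: le_trans (psi_lip _ _ Ts Tt) _.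
    rewrite distrC ger0_norm ?subr_ge0// -mulrBr ler_wpM2r ?subr_ge0//.
    by rewrite ler_peMl.
  move=> p q g; have [eta [_ len etaE]] := gamma_gap _ _ g; have [_ _ _ pq _] := g.
  rewrite -mulrBr -mulrA.
  apply: has_budget_eq (has_budget_reparam pq (curve_length_budget ler01 len)).
  by move=> t pt tq; rewrite etaE.
have nu_dist (s t : R) : 0 <= s -> s <= t -> t <= 1 -> rho (c s) (c t) <= nu t - nu s.
  move=> hs hst ht; rewrite lerBrDl.
  exact: (seg_length_dist L_ge0 rhoP S_ge).
have lenY : (curve_length s0 t0 (Phi \o gamma) <= (M * C * (nu t0 - nu s0))%:E)%E.
  apply: budget_curve_length; rewrite mulrBr.
  apply: (glue_budget Tclosed Ts0 Tt0 (kappa := fun t => M * C * nu t)).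
    move=> s t Ts Tt s0s st tt0; rewrite /= !gammaT//.
    have [/andP[s1 s2] Fs] := Ts; have [/andP[t1 t2] Ft] := Tt.
    have := nu_dist s t s1 st (le_trans t2 tau1).
    rewrite (ext_mdistE (psi := fun x => Phi (phi x)))// => dnu.
    rewrite -mulrBr; apply: le_trans dnu _.
    rewrite ler_peMl//; apply: le_trans (nu_dist s t s1 st (le_trans t2 tau1)).
    exact: (lpm_ge0 rhoP).
  move=> p q g; have [eta [reta len etaE]] := gamma_gap _ _ g.
  have [[/andP[p0 ptau] _] [/andP[q0 qtau] _] sp pq [qt nT]] := g.
  have nF u : p < u -> u < q -> ~ F (c u).
    by move=> pu uq Fu; apply: (nT u pu uq); split=> //=; lra.
  have growth := seg_length_gap p0 (ltW pq) (le_trans qtau tau1) nF.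
  apply: (@has_budgetS _ _ _ _ _ (M * (C * (L * `|h| * (q - p))))).
    by rewrite -mulrBr [leLHS]mulrA ler_wpM2l// mulr_ge0.
  have lenP := bld_le reta len.
  apply: has_budget_eq (has_budget_reparam pq (curve_length_budget ler01 lenP)).
  by move=> t pt tq; rewrite /= etaE.
have lenX := bld_ge rect lenY.
have mid : rhof (c s0) (c t0) <= M * (M * C) * (nu t0 - nu s0).
  rewrite ext_mdistE//.
  have := has_budget_dist s0t0 (curve_length_budget s0t0 lenX).
  by rewrite !gammaT// mulrA.
have first_ : rhof (c 0) (c s0) <= M * (M * C) * (nu s0 - nu 0).
  apply: rhof_gap => // u u0 us.
  by apply: out; [exact: ltW|exact: le_trans (ltW us) s0tau|left].
have last_ : rhof (c t0) (c tau) <= M * (M * C) * (nu tau - nu t0).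
  apply: rhof_gap => // u u0 us.
  by apply: out; [exact: le_trans t00 (ltW u0)|exact: ltW|right].
rewrite c0 in first_.
have tri1 := lpm_tri rhofP (c s0) z (c tau).
have tri2 := lpm_tri rhofP (c t0) (c s0) (c tau).
have -> : M * (M * C) * (nu tau - nu 0) = M * (M * C) * (nu s0 - nu 0) +
  (M * (M * C) * (nu t0 - nu s0) + M * (M * C) * (nu tau - nu t0)) by ring.
exact: le_trans tri1 (lerD first_ (le_trans tri2 (lerD mid last_))).
Qed.

End segment.
End curve_bound.

(** The inequality that selects the value at a limit point of [E] also forces the value
   at a point of [E] to be that of [f]. *)
Lemma lipschitz_extension (R : realType) (X : metricType R) (k : nat) (E : set 'rV[R]_k)
    (f : E -> X) (L : R) (x0 : E) : complete_metric X -> 0 <= L ->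
  (forall x y : E, mdist (f x) (f y) <= L * `|val x - val y|) ->
  exists phi : 'rV[R]_k -> X, (forall x : E, phi (val x) = f x) /\
    forall x y, closure E x -> closure E y -> mdist (phi x) (phi y) <= L * `|x - y|.
Proof.
move=> Xc L0 fL.
have near_E (x : 'rV[R]_k) (e : R) : closure E x -> 0 < e -> exists a : E, `|x - val a| < e.
  move=> Ex e0; have [a [Ea xa]] := Ex _ (nbhsx_ballx x e e0).
  by exists (exist _ a (mem_set Ea)); rewrite -ball_normE in xa.
have lim x : closure E x -> exists y, forall a : E, mdist y (f a) <= L * `|x - val a|.
  move=> Ex.
  have /choice[a aP] : forall n, exists a : E, `|x - val a| < 2 ^- n.
    by move=> n; apply: near_E => //; rewrite invr_gt0 exprn_gt0.
  have faL n m : (n <= m)%N -> mdist (f (a n)) (f (a m)) <= 2 * L * 2 ^- n.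
    move=> nm; apply: le_trans (fL _ _) _; rewrite (mulrC 2) -mulrA ler_wpM2l//.
    rewrite -[_ - _](subrKA x); apply: le_trans (ler_normD _ _) _.
    rewrite distrC; have := aP n; have := aP m.
    have : 2 ^- m <= 2 ^- n :> R.
      by rewrite lef_pV2 ?posrE ?exprn_gt0// ler_weXn2l// ler1n.
    lra.
  have small (e : R) : 0 < e -> exists n, 2 * L * 2 ^- n < e.
    move=> e0; exists (Num.truncn (2 * L / e)).+1.
    rewrite ltr_pdivrMr ?exprn_gt0// [X in _ < X]mulrC -ltr_pdivrMr//.
    apply: lt_le_trans (truncnS_gt _) _; move: (Num.truncn _).+1 => n.
    by rewrite -natrX ler_nat ltnW// ltn_expl.
  have /Xc[y ay] : cauchy ((f \o a) @ \oo).
    apply: cauchy_exP => e e0; have [n ne] := small e e0.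
    exists (f (a n)); exists n => // m /= nm.
    by rewrite ballEmdist /=; exact: le_lt_trans (faL _ _ nm) ne.
  exists y => b; apply/ler_addgt0Pr => e e0.
  have e2 : 0 < e / 2 by rewrite divr_gt0.
  have [n ne] := small _ e2.
  have [N _ NP] := metricType_numDomainType.cvgr_dist_lt ay e2.
  pose m := maxn n N.
  have h1 := NP m (leq_maxr n N); rewrite /= in h1.
  have h2 := fL (a m) b.
  have h3 := aP m.
  have h4 : 2 ^- m <= 2 ^- n :> R.
    by rewrite lef_pV2 ?posrE ?exprn_gt0// ler_weXn2l ?ler1n// leq_maxl.
  have h5 : L * `|val (a m) - val b| <= L * (2 ^- n + `|x - val b|).
    rewrite ler_wpM2l// -[_ - _](subrKA x); apply: le_trans (ler_normD _ _) _.
    by rewrite distrC; lra.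
  have := metric_triangle y (f (a m)) (f b).
  have : 0 <= L * 2 ^- n by rewrite mulr_ge0// invr_ge0 exprn_ge0.
  by rewrite mulrDr in h5; rewrite -mulrA in ne; lra.
have /choice[phi phiP] : forall x, exists y, closure E x ->
    forall a : E, mdist y (f a) <= L * `|x - val a|.
  move=> x; have [/lim[y yP]|nEx] := pselect (closure E x); first by exists y.
  by exists (f x0).
exists phi; split=> [x|x y Ex Ey].
  have Ex : closure E (val x) by apply: subset_closure; exact: set_mem (valP x).
  apply: mdist_positivity; apply/eqP; rewrite eq_le mdist_ge0 andbT.
  by have := phiP _ Ex x; rewrite subrr normr0 mulr0.
apply/ler_addgt0Pr => e e0.
have L1 : 0 < 2 * L + 1 by lra.
have [a xa] := near_E x (e / (2 * L + 1)) Ex (divr_gt0 e0 L1).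
have h1 := phiP x Ex a; have h2 := phiP y Ey a.
have h3 : L * `|y - val a| <= L * (`|x - y| + `|x - val a|).
  by rewrite ler_wpM2l// (distrC x) -[y - val a](subrKA x) ler_normD.
have h4 : `|x - val a| * (2 * L + 1) < e by rewrite -ltr_pdivlMr.
have := metric_triangle (phi x) (f a) (phi y); rewrite (metric_sym (f a)).
have := normr_ge0 (x - val a).
rewrite mulrDr in h3; move: h4 (mulrC `|x - val a| L); rewrite mulrDr mulrCA mulr1; lra.
Qed.

Lemma euclidean_dist_le (R : realType) (k : nat) (x y : 'rV[R]_k) :
  euclidean_dist x y <= k%:R * `|x - y|.
Proof.
rewrite /euclidean_dist -[leRHS]ger0_norm ?mulr_ge0// -sqrtr_sqr ler_wsqrtr//.
apply: (@le_trans _ _ (k%:R * `|x - y| ^+ 2)).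
  have -> : k%:R * `|x - y| ^+ 2 = \sum_(i < k) `|x - y| ^+ 2.
    by rewrite sumr_const card_ord mulr_natl.
  apply: ler_sum => i _.
  rewrite -real_normK ?num_real// lerXn2r ?nnegrE//.
  by have := ler_rV_norm (x - y) i; rewrite !mxE.
rewrite exprMn ler_wpM2r ?sqr_ge0//; case: k {x y} => [|k]; first by rewrite expr0n.
by rewrite -natrX ler_nat leq_pmulr.
Qed.

Theorem theorem1p1 (R : realType) (X Y : metricType R)
  (Xcomplete : complete_metric X) (Xquasiconvex : quasiconvex X)
  (Phi : X -> Y) (PhiBLD : weak_BLD Phi)
  (k : nat) (k_gt0 : (0 < k)%N)
  (E : set 'rV[R]_k) (Emeas : lebesgue_measurable E)
  (f : E -> X) (flip : lipschitz_map f) :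
  hausdorff_measure k (range f) = 0%E <->
  hausdorff_measure k (Phi @` range f) = 0%E.
Proof.
have [M M1 bld] := PhiBLD; have [C C1 qc] := Xquasiconvex.
have PhiL := BLD_lipschitz M1 bld qc.
have MC0 : 0 <= M * C by rewrite mulr_ge0// (le_trans ler01).
rewrite !hausdorff_null//; split.
  by apply: null_lipschitz MC0 _ => // x y _ _; exact: PhiL.
have [[x0 _]|Eempty] := pselect (exists x : E, True); last first.
  move=> _ eta eta0; exists (fun=> set0), (fun=> 0); split=> // [y [x _ <-]|s _].
    by case: Eempty; exists x.
  by rewrite big1 ?ltW// => i _; rewrite expr0n eqn0Ngt k_gt0.
have [L0 L00 fL0] := flip; pose L1 := L0 * k%:R.
have L10 : 0 <= L1 by rewrite mulr_ge0.
have fL1 (x y : E) : mdist (f x) (f y) <= L1 * `|val x - val y|.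
  apply: le_trans (fL0 x y) _; rewrite -mulrA ler_wpM2l//; exact: euclidean_dist_le.
have [phi [phif phiL1]] := lipschitz_extension x0 Xcomplete L10 fL1.
pose L := L1 + M * C * L1; have L_ge0 : 0 <= L by rewrite addr_ge0// mulr_ge0.
have phiL x y : closure E x -> closure E y -> mdist (phi x) (phi y) <= L * `|x - y|.
  move=> Ex Ey; apply: le_trans (phiL1 x y Ex Ey) _.
  by rewrite ler_wpM2r// lerDl mulr_ge0.
have PhiphiL x y : closure E x -> closure E y ->
    mdist (Phi (phi x)) (Phi (phi y)) <= L * `|x - y|.
  move=> Ex Ey; apply: le_trans (PhiL _ _) _.
  apply: le_trans (ler_wpM2l MC0 (phiL1 x y Ex Ey)) _.
  by rewrite mulrA ler_wpM2r// lerDr.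
have rangeE : range f = phi @` E.
  apply/seteqP; split=> [_ [x _ <-]|_ [x Ex <-]].
    by exists (val x); [exact: set_mem (valP x)|exact: phif].
  by exists (exist _ x (mem_set Ex)) => //; rewrite -phif.
rewrite rangeE image_comp !null_image//.
have EF x : E x -> closure E x by exact: subset_closure.
have rP := ext_mdistP (psi := fun x => Phi (phi x)) L_ge0 PhiphiL.
have rfP := ext_mdistP L_ge0 phiL.
have Fc : closed (closure E) by exact: closed_closure.
move=> Pn.
have {Pn} : null (ext_metric L (closure E) (fun x y => mdist (Phi (phi x)) (Phi (phi y)))) k E.
  apply: (eq_null k_gt0 _).1 Pn => x y Ex Ey /=.
  by rewrite (ext_mdistE (psi := fun x => Phi (phi x)))//; exact: EF.
move=> Pn.
have K0 : 0 <= M * (M * C) by rewrite mulr_ge0// (le_trans ler01).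
have := null_transfer_pos k_gt0 L_ge0 K0 rP rfP
  (fun z h S hS => segment_bound M1 C1 bld qc L_ge0 Fc phiL PhiphiL hS) Pn.
apply: (eq_null k_gt0 _).1 => x y Ex Ey /=.
by rewrite ext_mdistE//; exact: EF.
Qed.
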